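(* Let $\Gamma$ be a connected ribbon graph of an abstract graph $G(V,E)$ and let $n>1$ be an integer. Then the filtered $n$-color homology counts $n$-face colorings on the ribbon graphs associated to the blowup of $\Gamma$: (1) The $i$th homology group of the filtered $n$-color homology is isomorphic to the direct sum of the spaces of harmonic colorings of the state graphs $\Gamma_\alpha$ with $|\alpha|=i$: $$\widehat{CH}^i_n(\Gamma;\mathbb{C}) \cong \bigoplus_{|\alpha|=i} \widehat{\mathcal{CH}}_n(\Gamma_\alpha).$$ In particular, if $\Gamma$ is planar, then the space of harmonic colorings of a state graph $\Gamma_\alpha$ of $\Gamma$ can be nonzero only when $|\alpha|$ is even. (2) The dimension of the space of harmonic colorings of a state graph $\Gamma_\alpha$ is equal to the number of $n$-face colorings of its closed associated surface $\overline{\Gamma}_\alpha$: $$\dim \widehat{\mathcal{CH}}_n(\Gamma_\alpha)=\#\{n\text{-face colorings of }\overline{\Gamma}_\alpha\}.$$ (3) The all-zero state graph $\Gamma_{\vec{0}}$, i.e., $\alpha=(0,0,\ldots,0)\in \{0,1\}^{|E|}$, of the blowup $\Gamma^\flat_E$ of $\Gamma$ is equivalent to the original ribbon graph $\Gamma$, and therefore $$\dim \widehat{CH}^0_n(\Gamma;\mathbb{C}) = \dim \widehat{\mathcal{CH}}_n(\Gamma_{\vec{0}})=\#\{n\text{-face colorings of }\overline{\Gamma}\}.$$ In particular, if $\Gamma$ is a plane graph of $G$ and $n=4$, then $\dim \widehat{CH}^0_4(\Gamma;\mathbb{C})$ counts the number of $4$-face colorings of $\Gamma$.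
   Context: Graphs are finite multigraphs. A ribbon graph $\Gamma$ of a connected graph $G(V,E)$ is a compact surface with boundary containing $G$ (as a 1-dimensional CW complex) that deformation retracts onto $G$; equivalently one disk per vertex and one band per edge (orientable or not). $\overline\Gamma$ is the closed surface obtained by gluing a disk (face) to each boundary component; two ribbon graphs are equivalent if there is a homeomorphism of the closed surfaces inducing an isomorphism of the underlying graphs. $\Gamma$ is planar (a plane graph) if $\overline\Gamma$ is a sphere. An $n$-face coloring of $\Gamma$ (or $\overline\Gamma$) assigns one of $n$ colors to each face so that the faces on the two sides of every edge have different colors (none exists if some edge has the same face on both sides). Write $E=\{e_1,\dots,e_\ell\}$. The blowup $\Gamma^\flat_E$ is the trivalent ribbon graph with perfect matching $E$ obtained by replacing each vertex by a circle to which the edges are attached in the same cyclic order. For $\alpha\in\{0,1\}^{\ell}$, the state graph $\Gamma_\alpha$ is the ribbon graph of $G$ obtained from $\Gamma$ by inserting a half-twist in the band of $e_i$ for each $i$ with $\alpha_i=1$; the state $\Gamma_\alpha$ of the blowup is the set of boundary circles of this state graph, $k_\alpha$ its number of circles, $|\alpha|=\sum\alpha_i$. If $\alpha'$ is obtained from $\alpha$ by changing one $0$ (in position $p$) to $1$, then passing from $\Gamma_\alpha$ to $\Gamma_{\alpha'}$ either fuses two circles into one, splits one circle into two, or changes one circle to one circle. Filtered $n$-color homology: $m=\lfloor n/2\rfloor$, $\widehat V=\mathbb{C}[x]/(x^n-1)$, $\widehat V_\alpha=\widehat V^{\otimes k_\alpha}$ (one factor per circle), $\widehat C^i(\Gamma)=\bigoplus_{|\alpha|=i}\widehat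 V_\alpha$. The map $\widehat\partial_{\alpha\alpha'}:\widehat V_\alpha\to\widehat V_{\alpha'}$ is the identity on unaffected circles, and on the affected ones in the fuse/split/one-to-one case respectively $\widehat m(x^i\otimes x^j)=x^{i+j}$; $\widehat\Delta(x^k)=\sum_{0\le i,j<n,\ i+j\equiv k+2m \bmod n}x^i\otimes x^j$; $\widehat\eta(x^k)=\sqrt n\,x^{k+m}$. $\widehat\partial|_{\widehat V_\alpha}=\sum_{\alpha'}(-1)^{\alpha_1+\dots+\alpha_{p-1}}\widehat\partial_{\alpha\alpha'}$, and $\widehat{CH}^i_n(\Gamma;\mathbb{C})$ is the $i$th homology of $(\widehat C^*(\Gamma),\widehat\partial)$. Color basis: with $\lambda=e^{2\pi \mathrm{i}/n}$, $c_i=\frac1n\sum_{j=0}^{n-1}\lambda^{ij}x^j$, $0\le i\le n-1$, is a basis of $\widehat V$; tensor products $c_{i_1}\otimes\cdots\otimes c_{i_{k_\alpha}}$ form a basis of $\widehat V_\alpha$ (colorings of the state). Give $\widehat C^*(\Gamma)$ the Hermitian metric for which all colorings of all states are orthonormal, and let $\widehat\partial^*:\widehat C^i\to\widehat C^{i-1}$ be the adjoint of $\widehat\partial$. The space of harmonic colorings of the state (graph) $\Gamma_\alpha$ is $\widehat{\mathcal{CH}}_n(\Gamma_\alpha)=\{v\in\widehat V_\alpha:\widehat\partial v=0,\ \widehat\partial^*v=0\}$. *)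

(* Defs.v *)
From HB Require Import structures.
From mathcomp Require Import all_boot all_order all_algebra.
From mathcomp Require Import fingroup perm.
From mathcomp Require Import generic_quotient ring_quotient.
From mathcomp Require Import complex.
From mathcomp Require Import reals trigo.

Set Implicit Arguments.
Unset Strict Implicit.
Unset Printing Implicit Defensive.

Import Order.TTheory GRing.Theory Num.Theory.

Local Open Scope ring_scope.
Local Open Scope complex_scope.

Section VectorQuotient.
Local Open Scope quotient_scope.
Variables (K : fieldType) (V : vectType K) (W : {vspace V}).

Definition vquot := @Quotient.quot V W.
HB.instance Definition _ := GRing.Zmodule.on vquot.

Definition vpi (v : V) : vquot := \pi_(@Quotient.quot V W) v.
Definition vrepr (x : vquot) : V := @repr _ (@Quotient.quot V W) x.

Lemma vreprK x : vpi (vrepr x) = x.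
Proof. exact: reprK. Qed.

Lemma vpiE u v : (vpi u = vpi v) <-> (u - v \in W).
Proof.
rewrite -[_ \in _]/(@Quotient.equiv V W u v).
split=> [/eqP|h]; first by rewrite piE.
by apply/eqP; rewrite piE.
Qed.

Lemma vpiD u v : vpi (u + v) = vpi u + vpi v.
Proof. by rewrite /vpi piE. Qed.

Lemma vrepr_vpi v : vrepr (vpi v) - v \in W.
Proof. by apply/vpiE; rewrite vreprK. Qed.

Definition vquot_scale (a : K) (x : vquot) : vquot := vpi (a *: vrepr x).

Lemma vpiZ a v : vpi (a *: v) = vquot_scale a (vpi v).
Proof.
by apply/vpiE; rewrite -scalerBr -opprB scalerN rpredN rpredZ ?vrepr_vpi.
Qed.

Lemma vquot_scaleA a b x :
  vquot_scale a (vquot_scale b x) = vquot_scale (a * b) x.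
Proof. by rewrite -[x]vreprK -!vpiZ scalerA. Qed.
Lemma vquot_scale1 : left_id 1 vquot_scale.
Proof. by move=> x; rewrite -[x]vreprK -!vpiZ scale1r. Qed.
Lemma vquot_scaleDr : right_distributive vquot_scale +%R.
Proof.
by move=> a x y; rewrite -[x]vreprK -[y]vreprK -vpiD -!vpiZ scalerDr vpiD.
Qed.
Lemma vquot_scaleDl x : {morph vquot_scale^~ x : a b / a + b}.
Proof. by move=> a b; rewrite -[x]vreprK -!vpiZ scalerDl vpiD. Qed.

HB.instance Definition _ := GRing.Zmodule_isLmodule.Build K vquot
  vquot_scaleA vquot_scale1 vquot_scaleDr vquot_scaleDl.

Lemma vquot_vect_iso : Vector.axiom (\dim W^C) vquot.
Proof.
pose co (v : V) := v - projv W v.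
have coE u v : vpi u = vpi v -> co u = co v.
  move/vpiE=> uvW; apply/eqP; rewrite -subr_eq0.
  have -> : co u - co v = (u - v) - projv W (u - v).
    rewrite /co [projv W (u - v)]linearB /= !opprB addrACA [RHS]addrACA.
    by congr (_ + _); rewrite addrC.
  by rewrite projv_id ?subrr.
have coC v : co v \in (W^C)%VS by exact: memv_projC.
have coL a u v : co (a *: u + v) = a *: co u + co v.
  by rewrite /co linearP /= opprD addrACA -scalerBr.
exists (fun x => \row_i coord (vbasis W^C) i (co (vrepr x))).
  move=> a x y; apply/rowP=> i; rewrite !mxE -linearP -coL; congr (coord _ _ _).
  apply: coE; rewrite vreprK vpiD vpiZ !vreprK.
  by [].
exists (fun r : 'rV_(\dim W^C) => vpi (\sum_i r 0 i *: (vbasis W^C)`_i)).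
  move=> x /=; rewrite -[RHS]vreprK; apply/vpiE.
  under eq_bigr do rewrite mxE.
  rewrite -(coord_vbasis (coC _)) /co addrAC subrr add0r rpredN.
  exact: memv_proj.
move=> r; apply/rowP=> i; rewrite mxE.
set w := \sum_j _.
have wC : w \in (W^C)%VS.
  by apply: rpred_sum => j _; rewrite rpredZ ?vbasis_mem ?memt_nth.
have -> : co (vrepr (vpi w)) = w.
  rewrite (coE _ w) ?vreprK // /co.
  suff -> : projv W w = 0 by rewrite subr0.
  by apply/eqP; rewrite -memv_ker lker_proj.
by rewrite coord_sum_free ?(basis_free (vbasisP _)).
Qed.
HB.instance Definition _ := Lmodule_hasFinDim.Build K vquot vquot_vect_iso.

End VectorQuotient.

Definition lin_isomorphic (K : fieldType) (U V : vectType K) : Prop :=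
  exists f : {linear U -> V}, bijective f.

(* Finite multigraphs, loops and parallel edges allowed, with an ordered edge
   set e_0, ..., e_(l-1); the two half-edges of e are (e, false), (e, true). *)
Record mgraph := MGraph {
  vert : finType;
  nedge : nat;
  hinc : 'I_nedge * bool -> vert
}.

Definition hedge (G : mgraph) : finType := ('I_(nedge G) * bool)%type.
Definition hopp (G : mgraph) (h : hedge G) : hedge G := (h.1, ~~ h.2).

Definition adj (G : mgraph) : rel (vert G) :=
  fun u v => [exists h : hedge G, (hinc h == u) && (hinc (hopp h) == v)].

Definition mconnected (G : mgraph) : Prop :=
  (0 < #|vert G|)%N /\ forall u v : vert G, connect (@adj G) u v.

(* A ribbon graph of G, as one (locally oriented) disk per vertex and one band
   per edge: rot h is the half-edge following h counterclockwise around its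
   vertex disk, and twist e tells whether the band of e reverses the chosen
   local orientations (a half-twisted band). *)
Record ribbon (G : mgraph) := Ribbon {
  rot : {perm hedge G};
  twist : {ffun 'I_(nedge G) -> bool};
  rot_cycle : forall h : hedge G,
    porbit rot h = [set h' : hedge G | hinc h' == hinc h]
}.

(* Equivalence: an isomorphism of the underlying graphs which, after reversing
   the local orientation of the disks of the vertices with flip v = true,
   carries cyclic orders to cyclic orders and twists to twists. *)
Definition ribbon_equiv (G G' : mgraph) (Γ : ribbon G) (Γ' : ribbon G') : Prop :=
  exists (fV : vert G -> vert G') (fH : hedge G -> hedge G')
         (flip : vert G -> bool),
  [/\ bijective fV,
      bijective fH,
      forall h, fH (hopp h) = hopp (fH h) /\ hinc (fH h) = fV (hinc h),
      forall h, if flip (hinc h) then rot Γ' (fH (rot Γ h)) = fH h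
                else rot Γ' (fH h) = fH (rot Γ h) &
      forall h, twist Γ' (fH h).1
                = twist Γ h.1 (+) flip (hinc h) (+) flip (hinc (hopp h))].

(* Where the band of a half-edge h is attached, its two corners on the vertex
   circle are the flags (h, false) (clockwise) and (h, true) (counterclockwise).
   A vertex circle without flags is a boundary circle by itself, represented by
   inr v. *)
Definition bpoint (G : mgraph) : finType := ((hedge G * bool) + vert G)%type.

Definition on_boundary (G : mgraph) (x : bpoint G) : bool :=
  match x with
  | inl _ => true
  | inr v => [forall h : hedge G, hinc h != v]
  end.

(* One step along the boundary: along the arc of the vertex circle from h to
   rot h (these arcs are the edges of the vertex circles of the blowup), or
   along a side of the band of an edge. *)
Definition bstep (G : mgraph) (Γ : ribbon G) : rel (bpoint G) := fun x y =>
  match x, y with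
  | inl (h, s), inl (h', s') =>
      [|| [&& s, ~~ s' & h' == rot Γ h],
          [&& ~~ s, s' & h == rot Γ h'] |
          (h' == hopp h) && (s' == if twist Γ h.1 then s else ~~ s)]
  | _, _ => false
  end.

Definition circles (G : mgraph) (Γ : ribbon G) : {set {set bpoint G}} :=
  [set [set y | connect (bstep Γ) x y] | x in @on_boundary G].

(* The boundary circles of Γ; equivalently the faces of the closed surface
   obtained by capping them off with disks. *)
Definition circle (G : mgraph) (Γ : ribbon G) : finType :=
  {S : {set bpoint G} | S \in circles Γ}.

(* The closed surface is a sphere: it is connected with Euler characteristic
   #|V| - #|E| + #|F| = 2. *)
Definition planar (G : mgraph) (Γ : ribbon G) : Prop :=
  mconnected G /\ (#|vert G| + #|circle Γ| = nedge G + 2)%N.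

Definition face_coloring (n : nat) (G : mgraph) (Γ : ribbon G)
    (f : {ffun circle Γ -> 'I_n}) : bool :=
  [forall h : hedge G, forall F : circle Γ, forall F' : circle Γ,
    (inl (h, false) \in val F) && (inl (h, true) \in val F') ==> (f F != f F')].

Definition num_face_colorings (n : nat) (G : mgraph) (Γ : ribbon G) : nat :=
  #|[set f : {ffun circle Γ -> 'I_n} | face_coloring f]|.

Definition cube (G : mgraph) : finType := {ffun 'I_(nedge G) -> bool}.

Definition wt (G : mgraph) (α : cube G) : nat := (\sum_p α p)%N.

Definition set_bit (G : mgraph) (α : cube G) (p : 'I_(nedge G)) : cube G :=
  [ffun q => (q == p) || α q].

Definition state_graph (G : mgraph) (Γ : ribbon G) (α : cube G) : ribbon G :=
  @Ribbon G (rot Γ) [ffun e => twist Γ e (+) α e] (@rot_cycle G Γ).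

Definition affected (G : mgraph) (Γ : ribbon G) (p : 'I_(nedge G)) :
    {set circle Γ} :=
  [set S : circle Γ |
    [exists b : bool, exists s : bool, inl ((p, b), s) \in val S]].

Section Complex.
Variables (R : realType) (n : nat).
Local Notation C := R[i].

(* Structure constants of m^, Delta^, eta^ in the basis 1, x, ..., x^(n-1) of
   C[x]/(x^n - 1): the coefficient of the target monomial (the last one or two
   arguments) in the image of the source monomial. *)
Definition mhat (i j k : 'I_n) : C :=
  ((k : nat) == (i + j) %% n)%N%:R.
Definition Deltahat (k i j : 'I_n) : C :=
  (i + j == k + 2 * n./2 %[mod n])%N%:R.
Definition etahat (k l : 'I_n) : C :=
  sqrtC (n%:R : C) * ((l : nat) == (k + n./2) %% n)%N%:R.

Definition lambda : C :=
  cos (2 * pi / n%:R : R) +i* sin (2 * pi / n%:R : R).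

Variables (G : mgraph) (Γ : ribbon G).

(* The tensor power V_α, with one factor C[x]/(x^n - 1) for each circle S of
   the state, has as basis the monomials given by exponents a : S |-> a S. *)
Definition exponents (α : cube G) : finType :=
  {ffun circle (state_graph Γ α) -> 'I_n}.
Definition monomial : finType := {α : cube G & exponents α}.

(* The direct sum of all the V_α, as the space on the basis of all monomials. *)
Definition chain : vectType C := {ffun monomial -> C^o}.

Definition monom (b : monomial) : chain := [ffun b' => (b' == b)%:R].

Definition Vspace (α : cube G) : {vspace chain} :=
  (\sum_(b : monomial | tag b == α) <[monom b]>)%VS.

Definition Cspace (i : nat) : {vspace chain} :=
  (\sum_(α : cube G | wt α == i) Vspace α)%VS.

(* Matrix entry of the edge map V_α -> V_α' at position p. A circle not meeting
   the band of p is unaffected, and occurs as the same set of boundary points in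
   both states. The order in which enum lists two affected circles is immaterial
   since mhat and Deltahat are symmetric; the last case does not occur. *)
Definition edge_coef (p : 'I_(nedge G)) (α α' : cube G)
    (a : exponents α) (b : exponents α') : C :=
  [forall S : circle (state_graph Γ α), forall T : circle (state_graph Γ α'),
     (S \notin affected (state_graph Γ α) p) && (val S == val T)
       ==> (a S == b T)]%:R *
  match enum (affected (state_graph Γ α) p),
        enum (affected (state_graph Γ α') p) with
  | [:: S1; S2], [:: T1] => mhat (a S1) (a S2) (b T1)
  | [:: S1], [:: T1; T2] => Deltahat (a S1) (b T1) (b T2)
  | [:: S1], [:: T1] => etahat (a S1) (b T1)
  | _, _ => 0
  end.

Definition dhat_coef (x y : monomial) : C :=
  \sum_(p : 'I_(nedge G) | ~~ tag x p && (tag y == set_bit (tag x) p))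
     (-1) ^+ (\sum_(q : 'I_(nedge G) | (q < p)%N) tag x q)%N
     * edge_coef p (tagged x) (tagged y).

Definition dhat_fun (v : chain) : chain :=
  [ffun y => \sum_x v x * dhat_coef x y].

Fact dhat_fun_is_linear : linear dhat_fun.
Proof.
move=> k u v; apply/ffunP=> y; rewrite !ffunE scaler_sumr -big_split /=.
by apply: eq_bigr => x _; rewrite !ffunE mulrDl scalerAl.
Qed.
HB.instance Definition _ := GRing.isLinear.Build C chain chain _ dhat_fun
  dhat_fun_is_linear.

Definition dhat : 'End(chain) := linfun dhat_fun.

Definition cycles (i : nat) : {vspace chain} := (Cspace i :&: lker dhat)%VS.
Definition boundaries (i : nat) : {vspace chain} :=
  if i is j.+1 then (dhat @: Cspace j)%VS else 0%VS.

(* The boundaries are pulled back to the space of cycles. *)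
Definition homology (i : nat) : vectType C :=
  vquot (linfun (vsval : subvs_of (cycles i) -> chain) @^-1: boundaries i)%VS.

(* A coloring of a state assigns a color S |-> c S to each circle; it stands for
   the tensor product of the c_(c S), where c_k = 1/n sum_j lambda^(k j) x^j. It
   is thus indexed by the same type as the monomials. *)
Definition coloring (c : monomial) : chain :=
  [ffun b => if tag b == tag c
             then \prod_(F : circle (state_graph Γ (tag c)))
                    (n%:R^-1 * lambda ^+ (tagged c F * tagged_as c b F))
             else 0].

Definition colorings : #|monomial|.-tuple chain :=
  [tuple coloring (enum_val k) | k < #|monomial|].

(* The Hermitian metric for which all the colorings of all states are
   orthonormal. *)
Definition metric (u v : chain) : C :=
  \sum_k coord colorings k u * (coord colorings k v)^*.

(* The adjoint of d, expanded in the orthonormal basis of colorings. *)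
Definition dhat_adj_fun (v : chain) : chain :=
  \sum_c metric v (dhat (coloring c)) *: coloring c.

Fact dhat_adj_fun_is_linear : linear dhat_adj_fun.
Proof.
move=> k u v; rewrite /dhat_adj_fun scaler_sumr -big_split /=.
apply: eq_bigr => c _; rewrite scalerA -scalerDl; congr (_ *: _).
rewrite /metric mulr_sumr -big_split /=.
by apply: eq_bigr => j _; rewrite linearP /= mulrDl mulrA.
Qed.
HB.instance Definition _ := GRing.isLinear.Build C chain chain _ dhat_adj_fun
  dhat_adj_fun_is_linear.

Definition dhat_adj : 'End(chain) := linfun dhat_adj_fun.

(* The colorings are a basis, so that metric is the Hermitian form described
   above and dhat_adj is the adjoint of dhat. *)
Section WellDefined.
Hypothesis n_gt0 : (0 < n)%N.

Let theta : R := 2 * pi / n%:R.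

Fact lambdaX k : lambda ^+ k = cos (theta *+ k) +i* sin (theta *+ k).
Proof.
elim: k => [|k IH]; first by rewrite expr0 !mulr0n cos0 sin0.
rewrite exprS IH mulrS cosD sinD /lambda -/theta.
by congr (_ +i* _); rewrite addrC.
Qed.

Fact lambda_n : lambda ^+ n = 1.
Proof.
have -> : lambda ^+ n = cos (pi *+ 2 : R) +i* sin (pi *+ 2 : R).
  by rewrite lambdaX -mulr_natr divfK ?pnatr_eq0 -?lt0n // mulr_natl.
by rewrite cos2pi sin2pi.
Qed.

Fact lambda_neq0 : lambda != 0.
Proof.
apply/eqP=> l0; have := lambda_n; rewrite l0 expr0n eqn0Ngt n_gt0 /=.
by move/eqP; rewrite eq_sym oner_eq0.
Qed.

Fact lambda_neq1 k : (0 < k < n)%N -> lambda ^+ k != 1.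
Proof.
case/andP=> k0 kn; apply/eqP; rewrite lambdaX => -[c1 _].
pose h : R := pi * k%:R / n%:R.
have hE : theta *+ k = h *+ 2.
  rewrite /theta /h -[LHS]mulr_natr -[RHS]mulr_natl !mulrA.
  by rewrite -!mulrA [n%:R^-1 * _]mulrC.
have h0 : 0 < h by rewrite !mulr_gt0 ?pi_gt0 ?invr_gt0 ?ltr0n.
have hpi : h < pi.
  rewrite /h -mulrA gtr_pMr ?pi_gt0 // ltr_pdivrMr ?ltr0n //.
  by rewrite mul1r ltr_nat.
have /gt_eqF/negP[] : 0 < sin h by apply: sin_gt0_pi; rewrite h0.
have : sin h ^+ 2 = 0.
  rewrite sin2cos2; move: c1; rewrite hE cos_mulr2n => /eqP.
  rewrite subr_eq -mulr2n -(mulr_natr (cos h ^+ 2)) -[X in _ == X]mulr_natr !mulr_natr.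
  by rewrite eqr_pMn2r // => /eqP ->; rewrite subrr.
by move/eqP; rewrite sqrf_eq0.
Qed.

Fact sum_lambda (i j : 'I_n) :
  \sum_(k < n) n%:R^-1 * (lambda ^+ (k * i) / lambda ^+ (k * j)) = (i == j)%:R.
Proof.
have nC : (n%:R : C) != 0 by rewrite pnatr_eq0 -lt0n.
pose z := lambda ^+ i / lambda ^+ j.
have zE k : lambda ^+ (k * i) / lambda ^+ (k * j) = z ^+ k.
  by rewrite ![(k * _)%N]mulnC !exprM -expr_div_n.
under eq_bigr do rewrite zE.
rewrite -mulr_sumr; have [ij|ij] := eqVneq i j.
  rewrite /z ij divff ?expf_neq0 ?lambda_neq0 //.
  under eq_bigr do rewrite expr1n.
  by rewrite sumr_const card_ord mulVf.
have zn : z ^+ n = 1.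
  by rewrite /z expr_div_n -!exprM ![(_ * n)%N]mulnC !exprM lambda_n !expr1n divr1.
have z1 : z != 1.
  rewrite /z; apply/eqP=> h.
  have {h} h : lambda ^+ i = lambda ^+ j.
    by rewrite -[LHS](divfK (expf_neq0 j lambda_neq0)) h mul1r.
  wlog lt_ij : i j ij h {z zE zn} / (i < j)%N => [W|].
    case: (ltngtP i j) => [||/val_inj e]; first exact: W.
      by apply: W => //; rewrite eq_sym.
    by rewrite e eqxx in ij.
  have /negP[] : lambda ^+ (j - i) != 1.
    by apply: lambda_neq1; rewrite subn_gt0 lt_ij (leq_ltn_trans (leq_subr _ _)).
  apply/eqP/(mulfI (expf_neq0 i lambda_neq0)).
  by rewrite -exprD subnKC ?mulr1 // ltnW.
have : (z - 1) * \sum_(k < n) z ^+ k = 0 by rewrite -subrX1 zn subrr.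
by move/eqP; rewrite mulf_eq0 subr_eq0 (negPf z1) /= => /eqP ->; rewrite mulr0.
Qed.

Lemma monom_colorings (α : cube G) (a : exponents α) :
  monom (Tagged exponents a) =
  \sum_(c : exponents α)
     (\prod_F (lambda ^+ (c F * a F))^-1) *: coloring (Tagged exponents c).
Proof.
apply/ffunP=> -[β b]; rewrite sum_ffunE ffunE.
have [eβ|neβ] := eqVneq β α; last first.
  rewrite big1 => [|c _]; last by rewrite !ffunE /= (negPf neβ) scaler0.
  case: eqP => // /(congr1 tag) /= e; by rewrite e eqxx in neβ.
subst β.
under eq_bigr => c _ do
  rewrite !ffunE /= eqxx tagged_asE /= /GRing.scale /= -big_split /=.
rewrite -(bigA_distr_bigA (fun F (k : 'I_n) =>
  (lambda ^+ (k * a F))^-1 * (n%:R^-1 * lambda ^+ (k * b F)))) /=.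
under eq_bigr => F _.
  under eq_bigr do rewrite mulrCA [X in _ * X]mulrC.
  rewrite sum_lambda.
  over.
rewrite /= eq_Tagged /=.
have [->|ne] := eqVneq b a.
  by rewrite big1 // => F _; rewrite eqxx.
have /existsP[F neF] : [exists F, b F != a F].
  apply: contraNT ne; rewrite negb_exists => /forallP h.
  by apply/eqP/ffunP=> F; apply/eqP; have := h F; rewrite negbK.
by rewrite (bigD1 F) //= (negPf neF) mul0r.
Qed.

Lemma colorings_basis : basis_of fullv colorings.
Proof.
rewrite basisEdim size_tuple dimvf /dim /= muln1 leqnn andbT.
apply/subvP=> v _.
have -> : v = \sum_b v b *: monom b.
  apply/ffunP=> b; rewrite sum_ffunE (bigD1 b) //= big1 => [|b' nb'].
    by rewrite !ffunE eqxx addr0 /GRing.scale /= mulr1.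
  by rewrite !ffunE eq_sym (negPf nb') scaler0.
apply: memv_suml => -[α a] _; apply: memvZ.
rewrite monom_colorings; apply: memv_suml => c _; apply: memvZ.
apply: memv_span.
have <- : tnth colorings (enum_rank (Tagged exponents c : monomial))
          = coloring (Tagged exponents c).
  by rewrite tnth_mktuple enum_rankK.
exact: mem_tnth.
Qed.

Fact nth_colorings (k : 'I_#|monomial|) : colorings`_k = coloring (enum_val k).
Proof. by rewrite -tnth_nth tnth_mktuple. Qed.

Lemma metric_coloring (c c' : monomial) :
  metric (coloring c) (coloring c') = (c == c')%:R.
Proof.
have cE (e : monomial) : coloring e = colorings`_(enum_rank e).
  by rewrite nth_colorings enum_rankK.
have fc := basis_free colorings_basis.
rewrite /metric !cE (bigD1 (enum_rank c)) //= big1 => [|k nk].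
  rewrite !coord_free // eqxx mul1r addr0 rmorph_nat.
  by rewrite eq_sym (inj_eq enum_rank_inj) eq_sym.
by rewrite coord_free // eq_sym (negPf nk) mul0r.
Qed.

Lemma dhat_adjP (u v : chain) : metric (dhat u) v = metric u (dhat_adj v).
Proof.
have metricC x y : metric x y = (metric y x)^*.
  rewrite /metric rmorph_sum /=; apply: eq_bigr => k _.
  by rewrite rmorphM /= conjcK mulrC.
have metric_suml (I : finType) (a : I -> C) (w : I -> chain) x :
    metric (\sum_k a k *: w k) x = \sum_k a k * metric (w k) x.
  rewrite /metric; under eq_bigr do rewrite linear_sum mulr_suml.
  rewrite exchange_big /=; apply: eq_bigr => k _; rewrite mulr_sumr.
  by apply: eq_bigr => j _; rewrite linearZ /= mulrA.
have metric_col x c : metric x (coloring c) = coord colorings (enum_rank c) x.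
  rewrite [X in metric X _](coord_basis colorings_basis (memvf x)) metric_suml.
  under eq_bigr do rewrite nth_colorings metric_coloring.
  rewrite (bigD1 (enum_rank c)) //= big1 => [|k nk].
    by rewrite enum_rankK eqxx mulr1 addr0.
  by rewrite (can2_eq enum_valK enum_rankK) (negPf nk) mulr0.
rewrite [RHS]metricC [dhat_adj v]lfunE /= /dhat_adj_fun metric_suml rmorph_sum /=.
rewrite {1}(coord_basis colorings_basis (memvf u)) linear_sum /=.
under eq_bigr do rewrite linearZ /=.
rewrite metric_suml (reindex (@enum_rank monomial)) /=; last first.
  by apply: onW_bij; exact: enum_rank_bij.
apply: eq_bigr => c _; rewrite rmorphM /= -!metricC metric_col mulrC.
by rewrite nth_colorings enum_rankK.
Qed.
End WellDefined.

Definition harmonic (α : cube G) : {vspace chain} :=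
  (Vspace α :&: lker dhat :&: lker dhat_adj)%VS.

End Complex.

(* Main.v *)
(* In the basis of colorings the edge maps are diagonal: flipping the band of an
   edge carries a coloring that has the same color on both sides of the edge to a
   nonzero multiple of the same coloring of the other state, and kills all other
   colorings. Hence the complex splits into cubes, one for each coloring of the
   corners, whose directions are the edges with the same color on both sides. A
   cube of positive dimension is contractible and carries no harmonic vector,
   while the cubes of dimension zero are the face colorings of the state graphs.
   On a sphere, the circles of two different colors cross an even number of times,
   and in a face coloring every twisted edge is a crossing of two colors. *)

From HB Require Import structures.
Require Import Defs.
From mathcomp Require Import all_boot all_order all_algebra.
From mathcomp Require Import fingroup perm.
From mathcomp Require Import complex reals ring.

Set Implicit Arguments.
Unset Strict Implicit.
Unset Printing Implicit Defensive.

Import GRing.Theory Num.Theory VectorInternalTheory.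
Local Open Scope ring_scope.
Local Notation rot := Defs.rot.

(** Write [m] for [n./2]. Multiplication by [x^m], scaled by [sqrt n], acts on the color [c_l] by
    the scalar [omega l]. With [c_l] on every affected circle, fusion, one-to-one change and split
    produce [c_l] on every new circle with the factors [omega l ^ 0], [omega l ^ 1] and
    [omega l ^ 2]. The exponent is one plus the change in the number of circles, so multiplying a
    coloring by the product of [omega] over its circles leaves the same factor [omega l] in all
    three cases, and the squares of the cube anticommute by the signs alone. This rests on the fact
    that a half-twist never turns two circles into two others, shown by a parity count that makes
    sense without orientations. Colorings of different states live on different sets of circles.
    They are compared through the boundary points, which all states share: a function on points that
    is constant along arcs and bands is a function of the circle. The planar case runs over the
    field with two elements, where Euler's formula becomes a statement about ranks. *)

Definition point (G : mgraph) : finType := {x : bpoint G | on_boundary x}.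

Definition flag (G : mgraph) (z : hedge G * bool) : point G :=
  exist (@on_boundary G) (inl z) (erefl true).

(** * Boundary circles as classes of boundary points *)

Section Faces.
Variables (G : mgraph) (Γ : ribbon G).
Implicit Types (x y : point G) (h : hedge G) (s : bool).

Definition across h s : hedge G * bool :=
  (hopp h, if twist Γ h.1 then s else ~~ s).

Lemma hoppK h : hopp (hopp h) = h.
Proof. by case: h => e b; rewrite /hopp /= negbK. Qed.

Lemma acrossK h s : across (across h s).1 (across h s).2 = (h, s).
Proof. by rewrite /across /= hoppK; case: (twist Γ h.1); rewrite ?negbK. Qed.

Lemma bstep_sym : symmetric (bstep Γ).
Proof.
have sub u v : bstep Γ u v -> bstep Γ v u.
  case: u v => [[h s]|?] [[h' s']|?] //=.
  case/or3P=> [/and3P[-> -> ->]|/and3P[-> -> ->]|] //; first by rewrite orbT.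
  case/andP=> /eqP-> /eqP->; rewrite hoppK eqxx /=.
  by case: ifP; rewrite ?negbK eqxx !orbT.
by move=> u v; apply/idP/idP; apply: sub.
Qed.

Lemma connect_bstepC : connect_sym (bstep Γ).
Proof. exact: sym_connect_sym bstep_sym. Qed.

Fact face_subproof x : [set y | connect (bstep Γ) (val x) y] \in circles Γ.
Proof. by apply/imsetP; exists (val x) => //; exact: (valP x). Qed.

Definition face x : circle Γ :=
  exist (fun S => S \in circles Γ) _ (face_subproof x).

Lemma mem_face x u : (u \in val (face x)) = connect (bstep Γ) (val x) u.
Proof. by rewrite inE. Qed.

Lemma face_eq x y : (face x == face y) = connect (bstep Γ) (val x) (val y).
Proof.
apply/eqP/idP => [/(congr1 val) /= /setP/(_ (val y))|xy].
  by rewrite !inE connect0.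
apply: val_inj; apply/setP=> u; rewrite !inE.
exact: (same_connect connect_bstepC).
Qed.

Lemma mem_faceE x y : (val y \in val (face x)) = (face x == face y).
Proof. by rewrite mem_face face_eq. Qed.

Lemma face_surj (S : circle Γ) : exists x, face x == S.
Proof.
have /imsetP[u ub Su] := valP S.
by exists (exist (@on_boundary G) u ub); apply/eqP/val_inj.
Qed.

(** A chosen point makes a circle portable: [face Γ' (rep S)] is the circle of another state [Γ']
    through the same point. *)
Definition rep (S : circle Γ) : point G := xchoose (face_surj S).

Lemma repK : cancel rep face.
Proof. by move=> S; apply/eqP; exact: xchooseP (face_surj S). Qed.

Lemma mem_circle (S : circle Γ) x : (val x \in val S) = (S == face x).
Proof. by rewrite -{1}(repK S) mem_faceE repK. Qed.

Lemma circle_on_boundary (S : circle Γ) u : u \in val S -> on_boundary u.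
Proof.
rewrite -(repK S) mem_face => /connectP[q + ->].
case/lastP: q => [_|q v]; first exact: (valP (rep S)).
rewrite rcons_path last_rcons => /andP[_].
by case: v => // v; case: (last _ _) => [[]|].
Qed.

Lemma face_arc h : face (flag (h, true)) = face (flag (rot Γ h, false)).
Proof. by apply/eqP; rewrite face_eq connect1 //= eqxx. Qed.

Lemma face_across h s : face (flag (across h s)) = face (flag (h, s)).
Proof.
apply/eqP; rewrite face_eq connect_bstepC connect1 //= !eqxx.
by rewrite !orbT.
Qed.

(** Arcs and bands are kept apart because a half-twist changes one band and no arc. *)
Definition arc_invariant T (g : point G -> T) :=
  forall h, g (flag (h, true)) = g (flag (rot Γ h, false)).

Definition band_invariant T (g : point G -> T) :=
  forall h s, g (flag (across h s)) = g (flag (h, s)).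

Lemma face_invariant T (g : point G -> T) :
  arc_invariant g -> band_invariant g ->
  forall x y, face x = face y -> g x = g y.
Proof.
move=> ga gb x y /eqP; rewrite face_eq => /connectP[p].
elim: p x => [|u p IHp] x /=; first by move=> _ /val_inj->.
case/andP=> xu pu ey.
suff [z zu <-] : exists2 z, val z = u & g z = g x.
  by apply: IHp; rewrite zu.
case: x xu {ey} => -[[h s]|v] /= xv; case: u {pu} => [[h' s']|w] //=.
have flagE z (zb : on_boundary (inl z)) : exist (@on_boundary G) (inl z) zb = flag z.
  exact: val_inj.
case/or3P=> [/and3P[+ + /eqP->]|/and3P[+ + /eqP->]|/andP[/eqP-> /eqP->]].
- case: s xv => // xv _; case: s' => // _.
  by exists (flag (rot Γ h, false)); rewrite ?flagE -?ga.
- case: s xv => // xv _; case: s' => // _.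
  by exists (flag (h', true)); rewrite ?flagE -?ga.
- by exists (flag (across h s)); rewrite ?flagE ?gb.
Qed.

Lemma face_coloringP n (f : {ffun circle Γ -> 'I_n}) :
  reflect (forall e, f (face (flag ((e, false), false)))
                     != f (face (flag ((e, false), true))))
          (face_coloring f).
Proof.
apply: (iffP idP) => [/forallP fc e|fc].
  have := fc (e, false) => /forallP/(_ (face (flag ((e, false), false)))).
  move/forallP/(_ (face (flag ((e, false), true)))).
  by rewrite !(mem_faceE _ (flag _)) !eqxx.
(* The other end of a band meets the same two sides, possibly in the other order. *)
have fch h : f (face (flag (h, false))) != f (face (flag (h, true))).
  case: h => e [] //; rewrite -2!face_across /across /hopp /=.
  by case: ifP => // _; rewrite eq_sym.
apply/forallP=> h; apply/forallP=> F; apply/forallP=> F'; apply/implyP.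
rewrite (mem_circle F (flag _)) (mem_circle F' (flag _)).
by case/andP=> /eqP-> /eqP->.
Qed.

End Faces.

(** * Effect of one half-twist on the boundary circles *)

Section Twisting.
Variables (G : mgraph) (p : 'I_(nedge G)).

Let A : point G := flag ((p, false), false).
Let B : point G := flag ((p, false), true).

Definition twist_related (Γ1 Γ2 : ribbon G) :=
  rot Γ1 = rot Γ2 /\ forall e, twist Γ2 e = twist Γ1 e (+) (e == p).

Lemma twist_relatedC Γ1 Γ2 : twist_related Γ1 Γ2 -> twist_related Γ2 Γ1.
Proof. by case=> r t; split=> // e; rewrite t -addbA addbb addbF. Qed.

Lemma flags_of_band (Γ : ribbon G) T (g : point G -> T) :
  band_invariant Γ g ->
  forall b s, g (flag ((p, b), s)) = g A \/ g (flag ((p, b), s)) = g B.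
Proof.
move=> gb [] s; last by case: s; [right|left].
rewrite -gb /across /hopp /=.
by case: ifP => _; case: s; [right|left|left|right].
Qed.

Section Pair.
Variables Γ1 Γ2 : ribbon G.
Hypothesis tw : twist_related Γ1 Γ2.

(** If [g] agrees at [A] and [B], it has a single value at the four corners of the band of [p], so
    it cannot detect the twist. *)
Lemma twist_invariant T (g : point G -> T) :
  g A = g B -> arc_invariant Γ1 g -> band_invariant Γ1 g ->
  arc_invariant Γ2 g /\ band_invariant Γ2 g.
Proof.
case: tw => r t gAB ga gb; split=> [h|[e b] s]; first by rewrite -r ga.
have [->|ep] := eqVneq e p; last by rewrite -gb /across t /= (negPf ep) addbF.
have gp b' s' : g (flag ((p, b'), s')) = g A.
  by case: (flags_of_band gb b' s') => ->.
by rewrite /across /= !gp.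
Qed.

Lemma face_twist T (g : point G -> T) x y :
  g A = g B -> arc_invariant Γ1 g -> band_invariant Γ1 g ->
  face Γ2 x = face Γ2 y -> g x = g y.
Proof.
move=> gAB ga gb; have [ga2 gb2] := twist_invariant gAB ga gb.
exact: (face_invariant ga2 gb2).
Qed.

End Pair.

Lemma affectedE (Γ : ribbon G) : affected Γ p = [set face Γ A; face Γ B].
Proof.
apply/setP=> S; rewrite !inE; apply/existsP/orP.
  case=> b /existsP[s]; rewrite (mem_circle S (flag _)) => /eqP->.
  have [->|->] := flags_of_band (@face_across G Γ) b s; first by left.
  by right.
case=> /eqP->; exists false; apply/existsP; [exists false|exists true];
  by rewrite (mem_circle _ (flag _)).
Qed.

Lemma unaffected_twist (Γ1 Γ2 : ribbon G) x :
    twist_related Γ1 Γ2 -> face Γ1 x \notin affected Γ1 p ->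
  (face Γ2 x \notin affected Γ2 p)
  /\ forall y, (face Γ2 y == face Γ2 x) = (face Γ1 y == face Γ1 x).
Proof.
move=> tw; rewrite !affectedE !in_set2 !negb_or => /andP[xA xB].
(* The indicator of the circle of [x] in [Δ] vanishes at both [A] and [B], hence survives the
   twist. *)
have sub Δ Δ' (tw' : twist_related Δ Δ') :
    face Δ x != face Δ A -> face Δ x != face Δ B ->
    forall y, face Δ' y == face Δ' x -> face Δ y == face Δ x.
  move=> nA nB y /eqP e.
  have := @face_twist _ _ tw' _ (fun z => face Δ z == face Δ x) y x _ _ _ e.
  rewrite eqxx; apply=> [|h|h s].
  - by rewrite ![_ == face Δ x]eq_sym (negPf nA) (negPf nB).
  - by rewrite face_arc.
  - by rewrite face_across.
have xA2 : face Γ2 x != face Γ2 A.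
  by apply: contra (xA); rewrite ![_ == face _ A]eq_sym; apply: (sub _ _ tw).
have xB2 : face Γ2 x != face Γ2 B.
  by apply: contra (xB); rewrite ![_ == face _ B]eq_sym; apply: (sub _ _ tw).
split=> [|y]; first by rewrite xA2.
by apply/idP/idP; [exact: (sub _ _ tw)|exact: (sub _ _ (twist_relatedC tw))].
Qed.

Lemma unaffected_transfer (Γ1 Γ2 : ribbon G) (S : circle Γ1) :
    twist_related Γ1 Γ2 -> S \notin affected Γ1 p ->
  face Γ2 (rep S) \notin affected Γ2 p
  /\ face Γ1 (rep (face Γ2 (rep S))) = S.
Proof.
rewrite -{1}(repK S) => tw /(unaffected_twist tw)[-> eqf]; split=> //.
by apply/eqP; rewrite -{2}(repK S) -eqf repK.
Qed.

(* Otherwise the flags common to the circles of A in both states are paired up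
   along the arcs, and all of them but A along the bands. *)
Lemma face_split (Γ1 Γ2 : ribbon G) : twist_related Γ1 Γ2 ->
  face Γ1 A != face Γ1 B -> face Γ2 A = face Γ2 B.
Proof.
move=> tw n1; apply/eqP; apply: contraT => n2; exfalso.
pose X := [set z : hedge G * bool |
  (face Γ1 (flag z) == face Γ1 A) && (face Γ2 (flag z) == face Γ2 A)].
pose a : hedge G * bool := ((p, false), false).
have aX : a \in X by rewrite inE !eqxx.
(* Each corner at the far end is joined to [A] in one state and to [B] in the other, so it could lie
   in [X] only if some state had [A] and [B] on one circle. *)
have pX b s : ((p, b), s) \in X -> ((p, b), s) = a.
  rewrite inE; case: b s => [] [] //=.
  - rewrite -!(face_across _ (p, true)) /across /hopp /=.
    case: tw => _ ->; rewrite eqxx; case: (twist Γ1 p) => /=.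
      by rewrite eq_sym (negPf n1).
    by rewrite andbC eq_sym (negPf n2).
  - rewrite -!(face_across _ (p, true)) /across /hopp /=.
    case: tw => _ ->; rewrite eqxx; case: (twist Γ1 p) => /=.
      by rewrite andbC eq_sym (negPf n2).
    by rewrite eq_sym (negPf n1).
  - by rewrite eq_sym (negPf n1).
have half (Y : {set hedge G * bool}) (q : pred (hedge G * bool))
    (f g : hedge G * bool -> hedge G * bool) :
    cancel f g -> cancel g f ->
    (forall z, z \in Y -> q z -> (f z \in Y) && ~~ q (f z)) ->
    (forall z, z \in Y -> ~~ q z -> (g z \in Y) && q (g z)) ->
    ~~ odd #|Y|.
  move=> fK gK fY gY; rewrite -(cardsID [set z | q z] Y).
  suff -> : Y :\: [set z | q z] = f @: (Y :&: [set z | q z]).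
    by rewrite card_imset ?addnn ?odd_double //; exact: can_inj fK.
  apply/setP=> z; rewrite inE inE andbC; apply/andP/imsetP => [[zY nz]|[z' + ->]].
    by exists (g z); rewrite ?gK // !inE; exact: gY.
  by rewrite !inE => /andP[z'Y qz']; apply/andP; exact: fY.
have evenX : ~~ odd #|X|.
  pose σ (z : hedge G * bool) :=
    (if z.2 then rot Γ1 z.1 else (rot Γ1)^-1%g z.1, ~~ z.2).
  apply: (half X (fun z => z.2) σ σ); rewrite /σ.
  - by move=> [h []]; rewrite /= ?permK ?permKV.
  - by move=> [h []]; rewrite /= ?permK ?permKV.
  - move=> [h []] //; rewrite inE !face_arc => hX _ /=; rewrite andbT inE.
    by case: tw hX => -> _.
  - move=> [h []] //; rewrite inE => hX _ /=; rewrite andbT inE !face_arc permKV.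
    by case: tw => <- _; rewrite permKV.
have evenXa : ~~ odd #|X :\ a|.
  have abX z : z \in X :\ a -> across Γ1 z.1 z.2 \in X :\ a.
    case: z => [[e b] s]; rewrite 2!inE => /andP[na zX].
    have ep : e != p by apply: contraNneq na => ee; rewrite ee (pX b s) -?ee.
    rewrite !inE face_across.
    have -> : across Γ1 (e, b, s).1 (e, b, s).2 = across Γ2 (e, b) s.
      by rewrite /across /=; case: tw => _ ->; rewrite (negPf ep) addbF.
    rewrite face_across; move: zX; rewrite inE => -> /=; rewrite andbT.
    by apply/eqP => -[ee]; rewrite ee eqxx in ep.
  apply: (half (X :\ a) (fun z => z.1.2) (fun z => across Γ1 z.1 z.2)
            (fun z => across Γ1 z.1 z.2)).
  - by move=> [h s]; rewrite acrossK.
  - by move=> [h s]; rewrite acrossK.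
  - by move=> [[e b] s] zX hb; rewrite (abX _ zX) /= negbK.
  - by move=> [[e b] s] zX hb; rewrite (abX _ zX).
by move: evenX; rewrite (cardsD1 a) aX /= evenXa.
Qed.

Lemma card_affected_twist (Γ1 Γ2 : ribbon G) : twist_related Γ1 Γ2 ->
  [|| (#|affected Γ1 p| == 2) && (#|affected Γ2 p| == 1),
      (#|affected Γ1 p| == 1) && (#|affected Γ2 p| == 2) |
      (#|affected Γ1 p| == 1) && (#|affected Γ2 p| == 1)]%N.
Proof.
move=> tw; rewrite !affectedE !cards2.
have := face_split tw; case: (eqVneq (face Γ1 A)) => [_ _|n1 /(_ isT)->].
  by case: (_ != _).
by rewrite eqxx.
Qed.

End Twisting.

(** * The edge maps in the basis of colorings *)

Section ColorBasis.
Variables (R : realType) (n : nat) (n_gt0 : (0 < n)%N).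
Local Notation C := R[i].
Local Notation λ := (lambda R n).

Lemma lambda_modn l u : λ ^+ (l * u) = λ ^+ (l * (u %% n)).
Proof.
by rewrite {1}(divn_eq u n) mulnDr exprD mulnA exprM exprAC lambda_n // expr1n mul1r.
Qed.

Lemma sum_lambda_nat u v :
  \sum_(l < n) n%:R^-1 * (λ ^+ (l * u) / λ ^+ (l * v)) = (u == v %[mod n])%N%:R.
Proof.
under eq_bigr do rewrite (lambda_modn _ u) (lambda_modn _ v).
exact: (sum_lambda R n_gt0 (Ordinal (ltn_pmod u n_gt0)) (Ordinal (ltn_pmod v n_gt0))).
Qed.

(** The eigenvalue of the one-to-one map on the color [c_l]. *)
Definition omega (l : nat) : C := sqrtC (n%:R : C) / λ ^+ (l * n./2).

Lemma omega_neq0 l : omega l != 0.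
Proof.
rewrite mulf_neq0 ?invr_eq0 ?expf_neq0 ?lambda_neq0 //.
by rewrite sqrtC_eq0 pnatr_eq0 -lt0n.
Qed.

Variables (G : mgraph) (Γ : ribbon G).

(** Unlike [set_bit], this can also clear a bit: the homotopy and the adjoint go backwards along the
    edges of the cube. *)
Definition toggle (α : cube G) (p : 'I_(nedge G)) : cube G :=
  [ffun q => α q (+) (q == p)].

Lemma twist_related_toggle α p :
  twist_related p (state_graph Γ α) (state_graph Γ (toggle α p)).
Proof. by split=> // e; rewrite !ffunE addbA. Qed.

Section Edge.
Variables (α : cube G) (p : 'I_(nedge G)).
Let β := toggle α p.
Local Notation Γα := (state_graph Γ α).
Local Notation Γβ := (state_graph Γ β).
Local Notation exponents := (exponents n Γ).

Let tw : twist_related p Γα Γβ := twist_related_toggle α p.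

(** It is 0, 1 or 2 for a fusion, a one-to-one change or a split. The subtraction does not truncate,
    as at most two circles are affected before and at least one after. *)
Definition edge_exponent := (1 + #|affected Γβ p| - #|affected Γα p|)%N.

(** The product form of the compatibility condition lets sums over all exponents factor over the
    circles. *)
Lemma agree_unaffected (a : exponents α) (b : exponents β) :
  [forall S : circle Γα, forall T : circle Γβ,
     (S \notin affected Γα p) && (val S == val T) ==> (a S == b T)]%:R
  = \prod_(S | S \notin affected Γα p) (a S == b (face Γβ (rep S)))%:R :> C.
Proof.
have valE (S : circle Γα) : S \notin affected Γα p ->
    val S = val (face Γβ (rep S)).
  move=> nS; have nS' : face Γα (rep S) \notin affected Γα p by rewrite repK.
  have [_ eqf] := unaffected_twist tw nS'.
  rewrite -{1}(repK S); apply/setP => u.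
  have [ub|nub] := boolP (on_boundary u); last first.
    by apply/idP/idP => /circle_on_boundary ub; rewrite ub in nub.
  pose y : point G := exist (@on_boundary G) u ub.
  by rewrite -[u]/(val y) !mem_faceE ![_ == face _ y]eq_sym eqf.
rewrite -natr_prod; congr (_%:R); apply/eqP; rewrite eq_sym.
case: forallP => [agree|/forallP]; last first.
  rewrite negb_forall => /existsP[S]; rewrite negb_forall => /existsP[T].
  rewrite negb_imply => /andP[/andP[nS /eqP ST] nab].
  rewrite (bigD1 S) //= -(_ : T = face Γβ (rep S)) ?(negPf nab) //.
  by apply: val_inj; rewrite /= -ST valE.
rewrite big1 // => S nS.
have /forallP/(_ (face Γβ (rep S)))/implyP := agree S.
by rewrite nS -valE // eqxx => /(_ isT)->.
Qed.

(** Each structure constant is, up to [sqrt n], the indicator of a congruence mod [n]. Orthogonality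
    of the powers of [λ] expands it as a sum over colors [l], in whose terms the circles are
    independent. *)
Lemma edge_coefE (a : exponents α) (b : exponents β) :
  edge_coef R p a b =
  \prod_(S | S \notin affected Γα p) (a S == b (face Γβ (rep S)))%:R *
  \sum_(l < n) omega l ^+ edge_exponent
    * ((\prod_(S in affected Γα p) λ ^+ (l * a S))^-1
       * \prod_(T in affected Γβ p) (n%:R^-1 * λ ^+ (l * b T))).
Proof.
rewrite /edge_coef agree_unaffected; congr (_ * _).
under eq_bigr do rewrite -!big_enum.
have := card_affected_twist tw; rewrite /edge_exponent !cardE.
have nC : (n%:R : C) != 0 by rewrite pnatr_eq0 -lt0n.
have sqC : sqrtC (n%:R : C) ^+ 2 = n%:R by rewrite sqrtCK.
case: (enum (affected Γα p)) => [|S1 [|S2 [|? ?]]] //=;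
  case: (enum (affected Γβ p)) => [|T1 [|T2 [|? ?]]] //= _.
- rewrite /etahat -[X in X == _](modn_small (ltn_ord _)) -sum_lambda_nat mulr_sumr.
  apply: eq_bigr => l _; rewrite !big_seq1 -[(1 + 1 - 1)%N]/1%N expr1 /omega.
  by rewrite mulnDr exprD; move: (λ ^+ _) (λ ^+ _) (λ ^+ _) => x y z; rewrite invfM; ring.
- rewrite /Deltahat -sum_lambda_nat.
  apply: eq_bigr => l _; rewrite !big_cons !big_nil -[(1 + 2 - 1)%N]/2%N.
  rewrite /omega expr_div_n sqC !mulnDr !exprD muln0 expr0 mulr1.
  move: (λ ^+ _) (λ ^+ _) (λ ^+ _) (λ ^+ _) => x y z t.
  rewrite !mulr1 !invfM -[LHS]mulr1 -[X in _ * X = _](divff nC); ring.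
- rewrite /mhat -[X in X == _](modn_small (ltn_ord _)) -sum_lambda_nat.
  apply: eq_bigr => l _; rewrite !big_cons !big_nil -[(1 + 1 - 2)%N]/0%N expr0.
  by rewrite mulnDr exprD mul1r !mulr1 [RHS]mulrCA [X in _ = _ * X]mulrC.
Qed.

(** Meaningful when both sides of [p] have one color. Otherwise it may depend on the choice of
    [rep], but [edge_coloring] then multiplies it by zero. *)
Definition flip_coloring (c : exponents α) : exponents β :=
  [ffun T => c (face Γα (rep T))].

Lemma flip_coloring_face (c : exponents α) x :
    c (face Γα (flag ((p, false), false))) = c (face Γα (flag ((p, false), true))) ->
  flip_coloring c (face Γβ x) = c (face Γα x).
Proof.
move=> cAB; rewrite ffunE.
apply: (@face_twist _ p _ _ tw _ (fun y => c (face Γα y))) => [//|h|h s|].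
- by rewrite face_arc.
- by rewrite face_across.
- by rewrite repK.
Qed.

(** The circles away from the band of [p] correspond one to one in the two states, through their
    representatives. *)
Lemma unaffected_reindex (c : exponents α) (H : 'I_n -> circle Γβ -> C) :
  \prod_(S | S \notin affected Γα p) H (c S) (face Γβ (rep S))
  = \prod_(T | T \notin affected Γβ p) H (flip_coloring c T) T.
Proof.
pose h (T : circle Γβ) := face Γα (rep T); pose h' (S : circle Γα) := face Γβ (rep S).
have hK := unaffected_transfer tw; have h'K := unaffected_transfer (twist_relatedC tw).
rewrite (reindex_onto h h') /=; last by move=> S /hK[].
apply: eq_big => T; last first.
  by case/andP=> _ /eqP; rewrite /h' => ->; rewrite /flip_coloring ffunE.
rewrite /h /h'; apply/idP/idP => [/andP[/hK[+ _] /eqP e]|/h'K[-> ->]].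
  by rewrite e.
by rewrite eqxx.
Qed.

Lemma affected_flip (c : exponents α) T :
    c (face Γα (flag ((p, false), false))) = c (face Γα (flag ((p, false), true))) ->
  T \in affected Γβ p ->
  flip_coloring c T = c (face Γα (flag ((p, false), false))).
Proof.
by move=> cAB; rewrite affectedE !inE => /orP[] /eqP->; rewrite flip_coloring_face.
Qed.

Lemma affected_constant (c : exponents α) S :
    c (face Γα (flag ((p, false), false))) = c (face Γα (flag ((p, false), true))) ->
  S \in affected Γα p -> c S = c (face Γα (flag ((p, false), false))).
Proof. by move=> cAB; rewrite affectedE !inE => /orP[] /eqP->. Qed.

(** One factor [omega] per affected old circle becomes one per affected new circle; [edge_exponent]
    makes up the difference and leaves one factor over. *)
Lemma omega_flip (c : exponents α) :
    c (face Γα (flag ((p, false), false))) = c (face Γα (flag ((p, false), true))) ->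
  omega (c (face Γα (flag ((p, false), false)))) ^+ edge_exponent
    * \prod_S omega (c S)
  = omega (c (face Γα (flag ((p, false), false))))
    * \prod_T omega (flip_coloring c T).
Proof.
move=> cAB; rewrite (bigID (mem (affected Γα p))) /=.
rewrite [in RHS](bigID (mem (affected Γβ p))) /=.
rewrite (unaffected_reindex c (fun k _ => omega k)) !mulrA; congr (_ * _).
under [in LHS]eq_bigr => S Sp do rewrite (affected_constant cAB Sp).
under [in RHS]eq_bigr => T Tp do rewrite (affected_flip cAB Tp).
rewrite !prodr_const -exprD -exprS /edge_exponent; congr (_ ^+ _).
have := card_affected_twist tw.
by case/or3P=> /andP[/eqP-> /eqP->].
Qed.

(** Distributivity turns the sum over exponents into a product over circles. By orthogonality an
    affected circle forces [l] to be its color, so a term survives only if all affected circles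
    share that color; an unaffected circle keeps its own. *)
Lemma edge_coloring (c : exponents α) (b : exponents β) :
  \sum_(a : exponents α)
     (\prod_S (n%:R^-1 * λ ^+ (c S * a S))) * edge_coef R p a b
  = (c (face Γα (flag ((p, false), false))) == c (face Γα (flag ((p, false), true))))%:R
    * omega (c (face Γα (flag ((p, false), false)))) ^+ edge_exponent
    * \prod_T (n%:R^-1 * λ ^+ (flip_coloring c T * b T)).
Proof.
have flipE := @affected_flip c; move: flipE.
set SA := face Γα (flag (p, false, false)); set SB := face Γα (flag (p, false, true)).
move=> flipE.
under [LHS]eq_bigr do rewrite edge_coefE mulrA mulr_sumr.
rewrite exchange_big /=.
pose U := \prod_(S | S \notin affected Γα p)
            (n%:R^-1 * λ ^+ (c S * b (face Γβ (rep S)))).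
pose K l := omega l ^+ edge_exponent
     * \prod_(T in affected Γβ p) (n%:R^-1 * λ ^+ (l * b T)).
transitivity (\sum_(l < n) K l * (\prod_(S in affected Γα p) (c S == l)%:R * U)).
  apply: eq_bigr => l _.
  pose g S (k : 'I_n) := n%:R^-1 * λ ^+ (c S * k) *
    (if S \in affected Γα p then (λ ^+ (l * k))^-1
     else (k == b (face Γβ (rep S)))%:R).
  transitivity (\sum_(a : exponents α) K l * \prod_S g S (a S)).
    apply: eq_bigr => a _; rewrite /g [in RHS]big_split /= big_if prodfV /=.
    rewrite [RHS]mulrCA -[LHS]mulrA; congr (_ * _); rewrite /K -[RHS]mulrA.
    rewrite [LHS]mulrCA; congr (_ * _); rewrite [LHS]mulrCA [RHS]mulrCA.
    by congr (_ * _); rewrite mulrC.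
  rewrite -mulr_sumr -(bigA_distr_bigA g) /=; congr (_ * _).
  rewrite (bigID (mem (affected Γα p))) /=; congr (_ * _).
    apply: eq_bigr => S SA'; rewrite -(sum_lambda R n_gt0).
    by apply: eq_bigr => k _; rewrite /g SA' mulrA ![(k * _)%N]mulnC.
  apply: eq_bigr => S /negPf nS.
  rewrite (bigD1 (b (face Γβ (rep S)))) //= big1 => [|k /negPf nk].
    by rewrite /g nS eqxx mulr1 addr0.
  by rewrite /g nS nk mulr0.
have prodE l : \prod_(S in affected Γα p) (c S == l)%:R
             = ((c SA == l) && (c SB == l))%:R :> C.
  rewrite affectedE -/SA -/SB; have [eAB|nAB] := eqVneq SA SB.
    by rewrite eAB setUid big_set1 andbb.
  by rewrite big_setU1 ?inE //= big_set1 -natrM mulnb.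
under [LHS]eq_bigr do rewrite prodE.
have [cAB|nAB] := eqVneq (c SA) (c SB); last first.
  rewrite !mul0r big1 // => l _; case: eqP => [<-|_]; last by rewrite mul0r mulr0.
  by rewrite eq_sym (negPf nAB) mul0r mulr0.
rewrite (bigD1 (c SA)) //= big1 ?addr0 => [|l]; last first.
  by rewrite eq_sym => /negPf->; rewrite mul0r mulr0.
rewrite -cAB eqxx !mul1r /K -mulrA; congr (_ * _).
rewrite [RHS](bigID (mem (affected Γβ p))) /=; congr (_ * _).
  by apply: eq_bigr => T /flipE->.
by rewrite /U (unaffected_reindex c (fun k T => n%:R^-1 * λ ^+ (k * b T))).
Qed.
End Edge.

Local Notation monomial := (monomial n Γ).
Implicit Types (c : monomial) (p q : 'I_(nedge G)).

Definition point_color c (x : point G) : 'I_n :=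
  tagged c (face (state_graph Γ (tag c)) x).

Definition edge_color c p : 'I_n := point_color c (flag ((p, false), false)).

Definition mono c p := edge_color c p == point_color c (flag ((p, false), true)).

Definition flip p c : monomial :=
  Tagged (exponents n Γ) (flip_coloring p (tagged c)).

Lemma monomial_eq c c' :
  tag c = tag c' -> point_color c =1 point_color c' -> c = c'.
Proof.
case: c c' => [α c] [β c'] /= e; subst β => ecc.
congr (existT _ _ _); apply/ffunP => S.
by have := ecc (rep S); rewrite /point_color /= !repK.
Qed.

Lemma point_color_flip p c x :
  mono c p -> point_color (flip p c) x = point_color c x.
Proof. by move=> /eqP cp; apply: flip_coloring_face. Qed.

Lemma edge_color_flip p c q : mono c p -> edge_color (flip p c) q = edge_color c q.
Proof. exact: point_color_flip. Qed.

Lemma mono_flip p c q : mono c p -> mono (flip p c) q = mono c q.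
Proof. by move=> cp; rewrite /mono /edge_color !point_color_flip. Qed.

Lemma flipK p c : mono c p -> flip p (flip p c) = c.
Proof.
move=> cp; apply: monomial_eq => [|x].
  by apply/ffunP=> q; rewrite !ffunE -addbA addbb addbF.
by rewrite !point_color_flip ?mono_flip.
Qed.

Lemma flipC p q c : mono c p -> mono c q -> flip p (flip q c) = flip q (flip p c).
Proof.
move=> cp cq; apply: monomial_eq => [|x].
  by apply/ffunP=> r; rewrite !ffunE addbAC.
by rewrite !point_color_flip ?mono_flip.
Qed.

Lemma tag_flip p c q : tag (flip p c) q = tag c q (+) (q == p).
Proof. by rewrite ffunE. Qed.

Definition edge_sign (α : cube G) p : C :=
  (-1) ^+ (\sum_(q : 'I_(nedge G) | (q < p)%N) α q)%N.

Lemma edge_sign_neq0 α p : edge_sign α p != 0.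
Proof. by rewrite expf_neq0 // oppr_eq0 oner_eq0. Qed.

Lemma edge_sign_toggle α p q :
  edge_sign (toggle α q) p = if (q < p)%N then - edge_sign α p else edge_sign α p.
Proof.
rewrite /edge_sign; case: ifP => qp; last first.
  congr (_ ^+ _); apply: eq_bigr => r rp; rewrite ffunE.
  by have [e|] := eqVneq r q; [rewrite e qp in rp|rewrite addbF].
rewrite (bigD1 q) //= [in RHS](bigD1 q) //= !ffunE eqxx.
under [in LHS]eq_bigr => r /andP[_ /negPf rq] do rewrite ffunE rq addbF.
by rewrite !exprD -mulNr; case: (α q); rewrite /= ?expr1 ?expr0 ?opprK.
Qed.

(** Only the sign at the larger position counts the other bit, so exactly one of the two signs
    changes. *)
Lemma edge_sign_anticommute α p q : p != q ->
  edge_sign (toggle α p) q * edge_sign (toggle α q) p = - (edge_sign α p * edge_sign α q).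
Proof.
rewrite !edge_sign_toggle neq_ltn => /orP[] pq; rewrite pq ltnNge ltnW //=.
  by rewrite mulNr mulrC.
by rewrite mulrN mulrC.
Qed.

Lemma toggle_set_bit (α : cube G) p : ~~ α p -> set_bit α p = toggle α p.
Proof.
move=> /negPf ap; apply/ffunP=> q; rewrite !ffunE.
by have [->|] := eqVneq q p; rewrite ?ap ?addbF.
Qed.

Lemma dhat_coloring c :
  dhat R n Γ (coloring R c)
  = \sum_(p | mono c p && ~~ tag c p)
      (edge_sign (tag c) p * omega (edge_color c p) ^+ edge_exponent (tag c) p)
        *: coloring R (flip p c).
Proof.
apply/ffunP=> -[β b]; rewrite lfunE /= ffunE sum_ffunE.
transitivity (\sum_α' \sum_(a : exponents n Γ α')
    coloring R c (Tagged (exponents n Γ) a)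
      * dhat_coef R (Tagged (exponents n Γ) a) (Tagged (exponents n Γ) b)).
  by rewrite sig_big_dep; apply: eq_bigr => -[].
case: c => α c /=.
rewrite (bigD1 α) //= [X in _ + X]big1 ?addr0 => [|α' nα]; last first.
  by rewrite big1 // => a _; rewrite ffunE /= (negPf nα) mul0r.
rewrite /dhat_coef /=.
under eq_bigr do rewrite mulr_sumr.
rewrite exchange_big /= [RHS]big_mkcondl [LHS]big_mkcondr.
rewrite [RHS]big_mkcond [LHS]big_mkcond /=.
apply: eq_bigr => p _; rewrite !ffunE /=; case: ifP => // np.
rewrite toggle_set_bit //; case: (β =P toggle α p) => [eβ|nβ]; last first.
  by case: ifP => // _; case: (β =P toggle α p) => [//|_]; rewrite scaler0.
subst β.
under eq_bigr => a _.
  rewrite ffunE /= eqxx tagged_asE mulrCA.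
  over.
rewrite -mulr_sumr edge_coloring tagged_asE -/(edge_sign α p).
rewrite /mono /edge_color /point_color /=; case: eqP => _; last by rewrite !mul0r mulr0.
by rewrite mul1r /GRing.scale /= mulrA.
Qed.

End ColorBasis.

(** * Isomorphisms and subquotients through dimensions *)

Section Dimensions.
Variable (K : fieldType).

Lemma lkerP (U V : vectType K) (f : 'Hom(U, V)) u : reflect (f u = 0) (u \in lker f).
Proof. by rewrite memv_ker; exact: eqP. Qed.

Lemma lin_isomorphic_dim (U V : vectType K) :
  \dim {:U} = \dim {:V} -> lin_isomorphic U V.
Proof.
rewrite !dimvf => eUV.
have cast_lin m k (e : m = k) : linear (castmx (erefl 1%N, e) : 'rV[K]_m -> 'rV[K]_k).
  by case: k / e => a u v; rewrite !castmx_id.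
pose f (u : U) : V := r2v (castmx (erefl 1%N, eUV) (v2r u)).
have f_lin : linear f by move=> a u v; rewrite /f linearP cast_lin linearP.
pose F : {linear U -> V} := HB.pack f (GRing.isLinear.Build K U V _ f f_lin).
exists F.
exists (fun v => r2v (castmx (esym (erefl 1%N), esym eUV) (v2r v))) => [u|v].
  by rewrite -[F u]/(f u) /f r2vK castmxK v2rK.
by rewrite -[F _]/(f _) /f r2vK castmxKV v2rK.
Qed.

Lemma dim_vquot (V : vectType K) (W : {vspace V}) :
  \dim {:vquot W} = (\dim {:V} - \dim W)%N.
Proof. by rewrite [in LHS]dimvf -dimv_compl. Qed.

(** The inclusion of [Z] is injective, so the preimage of [B] is as large as [Z :&: B]. *)
Lemma dim_subquotient (V : vectType K) (Z B : {vspace V}) :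
  \dim {:vquot (linfun (vsval : subvs_of Z -> V) @^-1: B)} = (\dim Z - \dim (Z :&: B))%N.
Proof.
rewrite dim_vquot dimvf /dim /=; congr (_ - _)%N.
set f := linfun _.
have f_inj : lker f == 0%VS.
  by apply/lker0P => u v; rewrite !lfunE /=; exact: val_inj.
rewrite -(limg_dim_eq (_ : (f @^-1: B) :&: lker f = 0)%VS); last first.
  by rewrite (eqP f_inj) capv0.
congr (\dim _); apply/vspaceP=> v; rewrite memv_cap.
apply/memv_imgP/andP => [[u uB ->]|[vZ vB]].
  by rewrite -memv_preim in uB; rewrite uB lfunE subvsP.
by exists (Subvs vZ); rewrite -?memv_preim lfunE.
Qed.

End Dimensions.

(** The homotopy identity is asked only of the vectors in the sum because it fails on the face
    colorings. In total the part [h d] vanishes, the sum being a cycle. *)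
Lemma homotopy_cycle (K : fieldType) (V : lmodType K) (d h : {linear V -> V})
    (I : finType) (P : pred I) (a : I -> K) (b : I -> V) :
    (forall i, P i -> b i = d (h (b i)) + h (d (b i))) ->
    d (\sum_(i | P i) a i *: b i) = 0 ->
  \sum_(i | P i) a i *: b i = \sum_(i | P i) a i *: d (h (b i)).
Proof.
move=> bE db0; under eq_bigr => i Pi do rewrite (bE i Pi) scalerDr.
rewrite big_split /= -[RHS]addr0; congr (_ + _).
transitivity (h (d (\sum_(i | P i) a i *: b i))); last by rewrite db0 linear0.
by rewrite !linear_sum; apply: eq_bigr => i _; rewrite !linearZ.
Qed.

(* [d] flips bits from 0 to 1, in the directions allowed by [mono]; [h] undoes
   the flip in one direction, chosen in each cube by [pivot]. *)
Section CubeHomotopy.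
Variables (K : fieldType) (V : lmodType K) (I : Type) (E : finType).
Variables (mono bit : I -> pred E) (flip : E -> I -> I) (step : I -> E -> K).
Variables (b : I -> V) (d h : {linear V -> V}) (pivot : I -> option E).

Hypothesis mono_flip : forall p q c, mono c p -> mono (flip p c) q = mono c q.
Hypothesis flipK : forall p c, mono c p -> flip p (flip p c) = c.
Hypothesis flipC : forall p q c,
  mono c p -> mono c q -> flip p (flip q c) = flip q (flip p c).
Hypothesis bit_flip : forall p q c, bit (flip p c) q = bit c q (+) (q == p).
Hypothesis step_neq0 : forall c p, step c p != 0.
Hypothesis step_flip : forall c p, mono c p -> step (flip p c) p = step c p.
Hypothesis step_anticommute : forall c p q, p != q -> mono c p -> mono c q ->
  step (flip p c) q * step (flip q c) p = - (step c p * step c q).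
Hypothesis pivot_flip : forall p c, mono c p -> pivot (flip p c) = pivot c.
Hypothesis dE : forall c,
  d (b c) = \sum_(p | mono c p && ~~ bit c p) step c p *: b (flip p c).
Hypothesis hE : forall c, h (b c) =
  if pivot c is Some p then
    if bit c p then (step c p)^-1 *: b (flip p c) else 0
  else 0.

(** If the pivot bit is 0, only the pivot direction of [h d] survives and gives [b c]. If it is 1,
    the pivot direction of [d h] gives [b c], and any other direction occurs in both [d h] and
    [h d], with opposite signs by anticommutation. *)
Lemma cube_homotopy c p : pivot c = Some p -> mono c p ->
  b c = d (h (b c)) + h (d (b c)).
Proof.
move=> pc cp; rewrite dE linear_sum hE pc /=.
have hflip q : mono c q -> h (b (flip q c)) =
    if bit c p (+) (p == q) then (step (flip q c) p)^-1 *: b (flip p (flip q c)) else 0.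
  by move=> cq; rewrite hE pivot_flip // pc bit_flip.
have [cp1|cp0] := boolP (bit c p); last first.
  rewrite linear0 add0r (bigD1 p) ?cp //= linearZ /= hflip // (negPf cp0) eqxx /=.
  rewrite flipK // step_flip // scalerA divff // scale1r.
  rewrite big1 ?addr0 // => q /andP[/andP[cq _] nq].
  by rewrite linearZ /= hflip // (negPf cp0) eq_sym (negPf nq) scaler0.
rewrite linearZ /= dE scaler_sumr (bigD1 p) /=; last first.
  by rewrite mono_flip // cp bit_flip cp1 eqxx.
rewrite flipK // step_flip // scalerA mulVf // scale1r -addrA.
rewrite [X in _ + X](_ : _ = 0) ?addr0 //.
rewrite (eq_bigl (fun q => mono c q && ~~ bit c q)) => [|q]; last first.
  rewrite mono_flip // bit_flip; case: eqP => [->|_]; last by rewrite andbT addbF.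
  by rewrite andbF cp1 andbF.
rewrite -big_split big1 //= => q /andP[cq cq0].
have pq : p != q by apply: contraNneq cq0 => <-.
rewrite [X in _ + X]linearZ /= hflip // cp1 (negPf pq) /= !scalerA.
rewrite (flipC cq cp) -scalerDl.
have := step_anticommute pq cp cq; have := step_neq0 c p; have := step_neq0 (flip q c) p.
move: (step c p) (step c q) (step (flip p c) q) (step (flip q c) p) => x y w z z0 x0 wz.
suff -> : x^-1 * w = - (y * z^-1) by rewrite addNr scale0r.
by apply: (mulfI x0); rewrite mulrA divff // mul1r mulrN mulrA -mulNr -wz mulfK.
Qed.

End CubeHomotopy.

(** * Coordinates and subspaces in the basis of colorings *)

Section Chains.
Variables (R : realType) (n : nat) (n_gt0 : (0 < n)%N) (G : mgraph) (Γ : ribbon G).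
Local Notation C := R[i].
Local Notation chain := (chain R n Γ).
Local Notation monomial := (monomial n Γ).
Local Notation e := (@coloring R n G Γ).
Implicit Types (c : monomial) (p q : 'I_(nedge G)) (v : chain) (P : pred monomial).

Definition color_coord c v : C := coord (colorings R n Γ) (enum_rank c) v.
Local Notation cf := color_coord.

Definition color_span P : {vspace chain} := (\sum_(c | P c) <[e c]>)%VS.

Lemma color_coord_coloring c c' : cf c (e c') = (c' == c)%:R.
Proof.
rewrite /color_coord -{1}(enum_rankK c') -nth_colorings.
rewrite coord_free; last exact: basis_free (colorings_basis R Γ n_gt0).
by rewrite (inj_eq enum_rank_inj) eq_sym.
Qed.

Lemma coloring_expansion v : v = \sum_c cf c v *: e c.
Proof.
rewrite {1}(coord_basis (colorings_basis R Γ n_gt0) (memvf v)).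
rewrite (reindex (@enum_rank monomial)) /=; last first.
  by apply: onW_bij; exact: enum_rank_bij.
by apply: eq_bigr => c _; rewrite nth_colorings enum_rankK.
Qed.

Lemma color_coord_sum c I (r : seq I) (Q : pred I) (a : I -> C) (u : I -> chain) :
  cf c (\sum_(k <- r | Q k) a k *: u k) = \sum_(k <- r | Q k) a k * cf c (u k).
Proof.
by rewrite /color_coord linear_sum /=; apply: eq_bigr => k _; rewrite linearZ.
Qed.

Lemma color_coord0 c : cf c 0 = 0.
Proof. by rewrite /color_coord linear0. Qed.

Lemma color_coordZ c a v : cf c (a *: v) = a * cf c v.
Proof. by rewrite /color_coord linearZ. Qed.

Lemma color_coordD c u v : cf c (u + v) = cf c u + cf c v.
Proof. by rewrite /color_coord linearD. Qed.

Lemma metricE u v : metric u v = \sum_c cf c u * (cf c v)^*.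
Proof.
rewrite /metric (reindex (@enum_rank monomial)) //=.
by apply: onW_bij; exact: enum_rank_bij.
Qed.

Lemma color_coord_inj u v : (forall c, cf c u = cf c v) -> u = v.
Proof.
by move=> uv; rewrite (coloring_expansion u) (coloring_expansion v);
  apply: eq_bigr => c _; rewrite uv.
Qed.

Lemma mem_color_span P v :
  reflect (forall c, ~~ P c -> cf c v = 0) (v \in color_span P).
Proof.
apply: (iffP idP) => [/memv_sumP[u uP ->] c nc|v0].
  rewrite /color_coord linear_sum /= big1 // => c' Pc'.
  have /vlineP[k ->] := uP _ Pc'; rewrite linearZ /= -/(cf c _) color_coord_coloring.
  by case: eqP => [e|_]; rewrite ?mulr0 //; rewrite e (negPf nc) in Pc'.
rewrite (coloring_expansion v) (bigID P) /= [X in _ + X]big1 ?addr0 => [|c nc].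
  by apply: memv_sumr => c _; rewrite memvZ ?memv_line.
by rewrite v0 // scale0r.
Qed.

Lemma mem_coloring_span P c : P c -> e c \in color_span P.
Proof.
move=> Pc; apply/mem_color_span => c' nc'; rewrite color_coord_coloring.
by case: eqP => // cc'; rewrite -cc' Pc in nc'.
Qed.

Lemma color_span_expansion P v :
  v \in color_span P -> v = \sum_(c | P c) cf c v *: e c.
Proof.
move=> /mem_color_span v0; rewrite [LHS]coloring_expansion (bigID P) /=.
by rewrite [X in _ + X]big1 ?addr0 // => c /v0->; rewrite scale0r.
Qed.

Lemma dim_color_span P : \dim (color_span P) = #|P|.
Proof.
have e0 c : e c != 0.
  apply/eqP=> ec; have := color_coord_coloring c c.
  by rewrite ec /color_coord linear0 eqxx => /esym/eqP; rewrite oner_eq0.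
have /directvP/= -> : directv (\sum_(c | P c) <[e c]>)%VS.
  apply/directv_sum_independent => u uP u0 c Pc.
  have /vlineP[k uk] := uP c Pc.
  have : cf c (\sum_(c' | P c') u c') = k.
    rewrite /color_coord linear_sum (bigD1 c) //= uk linearZ /= -/(cf c _).
    rewrite color_coord_coloring eqxx /= mulr1 big1 ?addr0 // => c' /andP[Pc' nc].
    have /vlineP[k' ->] := uP c' Pc'.
    by rewrite linearZ /= -/(cf c _) color_coord_coloring (negPf nc) /= mulr0.
  by rewrite u0 /color_coord linear0 uk => <-; rewrite scale0r.
rewrite -sum1_card; apply: eq_bigr => c _.
by rewrite dim_vline e0.
Qed.

Lemma color_span_sub P Q : {subset P <= Q} -> (color_span P <= color_span Q)%VS.
Proof.
move=> PQ; apply/subvP=> v /mem_color_span v0; apply/mem_color_span => c nc.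
by apply: v0; apply: contra nc; exact: PQ.
Qed.

Lemma Vspace_color_span α : Vspace R n Γ α = color_span (fun c => tag c == α).
Proof.
apply/eqP; rewrite eqEsubv; apply/andP; split.
  apply/subv_sumP => -[β b] /= /eqP eβ; subst β; rewrite -memvE monom_colorings //.
  apply: memv_suml => c _; apply: memvZ; exact: mem_coloring_span.
apply/subv_sumP => c /eqP <-; rewrite -memvE.
have -> : e c = \sum_(b | tag b == tag c) e c b *: monom R b.
  apply/ffunP=> b; rewrite sum_ffunE.
  have termE b' : (e c b' *: monom R b') b = e c b' * (b == b')%:R.
    by rewrite ffunE /GRing.scale /= [in LHS](ffunE _ b).
  under eq_bigr do rewrite termE.
  have [ebc|nbc] := eqVneq (tag b) (tag c).
    rewrite (bigD1 b) ?ebc //= big1 ?addr0 => [|b' /andP[_ nb']].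
      by rewrite eqxx mulr1.
    by rewrite eq_sym (negPf nb') mulr0.
  rewrite [LHS]ffunE (negPf nbc) big1 // => b' eb'.
  by case: eqP => [ebb|_]; [rewrite ebb eb' in nbc|rewrite mulr0].
by apply: memv_sumr => b _; rewrite memvZ ?memv_line.
Qed.

Lemma sum_color_span (Q : pred (cube G)) (P : cube G -> pred monomial) :
    (forall α c, P α c -> tag c = α) ->
  (\sum_(α | Q α) color_span (P α))%VS = color_span (fun c => Q (tag c) && P (tag c) c).
Proof.
move=> Pt; rewrite /color_span (partition_big (@tag _ _) Q) => [|c /andP[]//] /=.
apply: eq_bigr => α Qα; apply: eq_bigl => c.
apply/idP/andP => [Pc|[/andP[_ + /eqP <-]]] //.
by rewrite (Pt _ _ Pc) Qα Pc eqxx.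
Qed.

End Chains.

(** * Harmonic vectors and face colorings *)

Section Harmonic.
Variables (R : realType) (n : nat) (n_gt0 : (0 < n)%N) (G : mgraph) (Γ : ribbon G).
Local Notation C := R[i].
Local Notation chain := (chain R n Γ).
Local Notation monomial := (monomial n Γ).
Local Notation e := (@coloring R n G Γ).
Local Notation cf := (@color_coord R n G Γ).
Local Notation span := (@color_span R n G Γ).
Local Notation d := (dhat R n Γ).
Implicit Types (c : monomial) (p q : 'I_(nedge G)) (v : chain) (P : pred monomial).

(** By [card_rainbow] these are the face colorings of the state graphs. *)
Definition rainbow c := [forall p, ~~ mono c p].

Definition dhat_entry c p : C :=
  edge_sign R (tag c) p * omega R n (edge_color c p) ^+ edge_exponent Γ (tag c) p.

Lemma dhat_entry_neq0 c p : dhat_entry c p != 0.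
Proof. by rewrite mulf_neq0 ?edge_sign_neq0 // expf_neq0 // omega_neq0. Qed.

Lemma dhat_coloringE c :
  d (e c) = \sum_(p | mono c p && ~~ tag c p) dhat_entry c p *: e (flip p c).
Proof. exact: dhat_coloring. Qed.

Lemma rainbow_flip c p : mono c p -> ~~ rainbow (flip p c).
Proof.
by move=> cp; rewrite negb_forall; apply/existsP; exists p; rewrite negbK mono_flip.
Qed.

Lemma color_coord_dhat c v :
  cf c (d v) = \sum_c' cf c' v *
    \sum_(p | mono c' p && ~~ tag c' p) dhat_entry c' p * (flip p c' == c)%:R.
Proof.
rewrite {1}(coloring_expansion n_gt0 v) linear_sum /=.
under eq_bigr do rewrite linearZ /=.
rewrite color_coord_sum; apply: eq_bigr => c' _; congr (_ * _).
rewrite dhat_coloringE color_coord_sum; apply: eq_bigr => p _.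
by rewrite color_coord_coloring.
Qed.

(** Any coloring reached by [d] was reached across an edge with equal sides, and the flip keeps them
    equal. *)
Lemma color_coord_dhat_rainbow c v : rainbow c -> cf c (d v) = 0.
Proof.
move=> rc; rewrite color_coord_dhat big1 // => c' _.
rewrite big1 ?mulr0 // => p /andP[cp _]; case: eqP => [ec|_]; last by rewrite mulr0.
by have := rainbow_flip cp; rewrite ec rc.
Qed.

Lemma color_coord_dhat_adj c v :
  cf c (dhat_adj R n Γ v)
  = \sum_(p | mono c p && ~~ tag c p) (dhat_entry c p)^* * cf (flip p c) v.
Proof.
rewrite lfunE /= /dhat_adj_fun color_coord_sum (bigD1 c) //=.
rewrite color_coord_coloring // eqxx mulr1 big1 ?addr0 => [|c' nc]; last first.
  by rewrite color_coord_coloring // (negPf nc) mulr0.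
rewrite metricE dhat_coloringE.
under [LHS]eq_bigr do rewrite color_coord_sum rmorph_sum mulr_sumr.
rewrite exchange_big /=; apply: eq_bigr => p _.
rewrite (bigD1 (flip p c)) //= color_coord_coloring // eqxx mulr1 mulrC.
rewrite big1 ?addr0 // => c' nc; rewrite color_coord_coloring //.
by rewrite eq_sym (negPf nc) mulr0 rmorph0 mulr0.
Qed.

Lemma toggleK (α : cube G) p : toggle (toggle α p) p = α.
Proof. by apply/ffunP=> q; rewrite !ffunE -addbA addbb addbF. Qed.

Lemma toggle_inj (α : cube G) : injective (toggle α).
Proof.
move=> p q /ffunP/(_ p); rewrite !ffunE eqxx => /addbI.
by case: eqP.
Qed.

(** Within one state nothing can cancel: distinct colorings of [α] never flip to the same coloring.
    So if [p] has equal sides in [c], the coordinate at [flip p c] of [d v], or of its adjoint when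
    the bit of [p] is 1, is a nonzero multiple of the coordinate of [v] at [c], which must
    vanish. *)
Lemma harmonic_color_span α :
  harmonic R n Γ α = span (fun c => (tag c == α) && rainbow c).
Proof.
rewrite /harmonic Vspace_color_span //.
apply/vspaceP=> v; apply/idP/idP; rewrite !memv_cap.
  case/andP=> /andP[/mem_color_span-/(_ n_gt0) vα] /lkerP dv /lkerP d'v.
  apply/mem_color_span => // c; have [ec|nc _] := eqVneq (tag c) α; last exact: vα.
  rewrite negb_forall => /existsP[p]; rewrite negbK => cp.
  have [cp1|cp0] := boolP (tag c p).
    have fp : mono (flip p c) p by rewrite mono_flip.
    have := color_coord_dhat_adj (flip p c) v.
    rewrite d'v color_coord0 => /esym.
    rewrite (bigD1 p) /= ?fp ?tag_flip ?cp1 ?eqxx // flipK //.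
    rewrite big1 ?addr0 => [|q /andP[/andP[cq _] qp]].
      by move/eqP; rewrite mulf_eq0 conjC_eq0 (negPf (dhat_entry_neq0 _ _)) => /eqP.
    rewrite vα ?mulr0 //; apply: contra qp => /eqP.
    move=> ef; apply/eqP/(@toggle_inj (toggle (tag c) p)).
    by rewrite toggleK; exact: etrans ef (esym ec).
  have := color_coord_dhat (flip p c) v.
  rewrite dv color_coord0 => /esym.
  rewrite (bigD1 c) //= (bigD1 p) ?cp //= eqxx mulr1.
  rewrite big1 ?addr0 => [|q /andP[_ qp]]; last first.
    case: eqP => [/(congr1 (@tag _ _))/toggle_inj eqp|_]; last by rewrite mulr0.
    by rewrite eqp eqxx in qp.
  rewrite big1 ?addr0 => [|c' nc].
    by move/eqP; rewrite mulf_eq0 (negPf (dhat_entry_neq0 _ _)) orbF => /eqP.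
  have [ec'|nc'] := eqVneq (tag c') α; last by rewrite vα ?mul0r.
  rewrite big1 ?mulr0 // => q /andP[cq _]; case: eqP => [eqf|_]; last by rewrite mulr0.
  have := congr1 (@tag _ _) eqf; rewrite /= ec ec' => /toggle_inj eqp; subst q.
  by case/eqP: nc; rewrite -(flipK cq) eqf flipK.
move=> vh; rewrite -andbA; apply/and3P; split.
- by apply: subvP vh; apply: color_span_sub => // c /andP[].
- rewrite memv_ker (color_span_expansion n_gt0 vh) linear_sum big1 //=.
  move=> c /andP[_ /forallP rc].
  rewrite linearZ /= dhat_coloringE big_pred0 ?scaler0 // => p.
  by rewrite (negPf (rc p)).
- rewrite memv_ker; apply/eqP/(color_coord_inj n_gt0) => c.
  rewrite color_coord_dhat_adj color_coord0 big1 // => p /andP[cp _].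
  move: vh => /(mem_color_span n_gt0) -> //; rewrite ?mulr0 //.
  by rewrite negb_and rainbow_flip ?orbT.
Qed.

Lemma card_rainbow α :
  #|[pred c : monomial | (tag c == α) && rainbow c]|
  = num_face_colorings n (state_graph Γ α).
Proof.
pose tg (f : exponents n Γ α) : monomial := Tagged (exponents n Γ) f.
rewrite /num_face_colorings -(card_imset _ (f := tg)).
  apply: eq_card => -[β f]; rewrite !inE /=.
  apply/andP/imsetP => [[/eqP eβ /forallP rf]|[f' + eff]].
    by subst β; exists f => //; rewrite inE; apply/face_coloringP.
  have eβ : β = α := congr1 (@tag _ _) eff.
  subst β; have := eff => /eqP; rewrite eq_Tagged /= => /eqP ->.
  rewrite inE => /face_coloringP rf; split=> //; exact/forallP.
by move=> f g /eqP; rewrite eq_Tagged => /eqP.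
Qed.

Lemma dim_harmonic α :
  \dim (harmonic R n Γ α) = num_face_colorings n (state_graph Γ α).
Proof. by rewrite harmonic_color_span dim_color_span // card_rainbow. Qed.

End Harmonic.

(** * The contracting homotopy and the homology *)

Section Homology.
Variables (R : realType) (n : nat) (n_gt0 : (0 < n)%N) (G : mgraph) (Γ : ribbon G).
Local Notation C := R[i].
Local Notation chain := (chain R n Γ).
Local Notation monomial := (monomial n Γ).
Local Notation e := (@coloring R n G Γ).
Local Notation cf := (@color_coord R n G Γ).
Local Notation span := (@color_span R n G Γ).
Local Notation d := (dhat R n Γ).
Implicit Types (c : monomial) (p q : 'I_(nedge G)) (v : chain) (P : pred monomial).

(** This absorbs [edge_exponent]: on [weighted] colorings the entries of [dhat] depend only on the
    sign and on the color at the edge. *)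
Definition weight c : C := \prod_S omega R n (tagged c S).

Definition step c p : C := edge_sign R (tag c) p * omega R n (edge_color c p).

Definition weighted c : chain := weight c *: e c.

Lemma weight_neq0 c : weight c != 0.
Proof. by apply/prodf_neq0 => S _; exact: omega_neq0. Qed.

Lemma step_neq0 c p : step c p != 0.
Proof. by rewrite mulf_neq0 ?edge_sign_neq0 ?omega_neq0. Qed.

Lemma dhat_weighted c :
  d (weighted c) = \sum_(p | mono c p && ~~ tag c p) step c p *: weighted (flip p c).
Proof.
rewrite linearZ /= dhat_coloringE // scaler_sumr; apply: eq_bigr => p /andP[/eqP cp _].
rewrite !scalerA; congr (_ *: _); rewrite /dhat_entry /step [LHS]mulrCA -[RHS]mulrA.
by congr (_ * _); rewrite [LHS]mulrC; exact: (omega_flip R (c := tagged c) cp).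
Qed.

Lemma step_flip c p : mono c p -> step (flip p c) p = step c p.
Proof. by move=> cp; rewrite /step edge_color_flip // edge_sign_toggle ltnn. Qed.

Lemma step_anticommute c p q : p != q -> mono c p -> mono c q ->
  step (flip p c) q * step (flip q c) p = - (step c p * step c q).
Proof.
move=> pq cp cq; rewrite /step !edge_color_flip //= mulrACA edge_sign_anticommute //.
by rewrite mulNr [in RHS]mulrACA; congr (- (_ * _)); exact: mulrC.
Qed.

(** The choice depends only on the set of edges with equal sides, which flips preserve, so it is
    constant on each cube. *)
Definition pivot c := [pick p | mono c p].

Lemma pivot_flip p c : mono c p -> pivot (flip p c) = pivot c.
Proof. by move=> cp; apply: eq_pick => q; exact: mono_flip. Qed.

(** The inverse of [weight c] is there because this is the value at [e c], not at [weighted c]. *)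
Definition homotopy_term c : chain :=
  if pivot c is Some p then
    if tag c p then ((weight c)^-1 * (step c p)^-1) *: weighted (flip p c) else 0
  else 0.

Definition homotopy v : chain := \sum_c cf c v *: homotopy_term c.

Fact homotopy_is_linear : linear homotopy.
Proof.
move=> k u v; rewrite /homotopy scaler_sumr -big_split /=; apply: eq_bigr => c _.
by rewrite color_coordD color_coordZ scalerDl scalerA.
Qed.
HB.instance Definition _ := GRing.isLinear.Build C chain chain _ homotopy
  homotopy_is_linear.

Lemma homotopy_weighted c : homotopy (weighted c) =
  if pivot c is Some p then
    if tag c p then (step c p)^-1 *: weighted (flip p c) else 0
  else 0.
Proof.
rewrite /homotopy (bigD1 c) //= big1 ?addr0 => [|c' nc].
  rewrite color_coordZ color_coord_coloring // eqxx mulr1 /homotopy_term.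
  case: pivot => [p|]; last by rewrite scaler0.
  case: ifP => _; last by rewrite scaler0.
  by rewrite scalerA mulrA divff ?mul1r ?weight_neq0.
rewrite color_coordZ color_coord_coloring // eq_sym (negPf nc).
by rewrite mulr0 scale0r.
Qed.

Lemma homotopyP c : ~~ rainbow c ->
  weighted c = d (homotopy (weighted c)) + homotopy (d (weighted c)).
Proof.
rewrite negb_forall => /existsP rc.
have [p [pc cp]] : exists p, pivot c = Some p /\ mono c p.
  case: rc => p0; rewrite negbK /pivot => cp0.
  by case: pickP => [p cp|/(_ p0)]; [exists p|rewrite cp0].
apply: (cube_homotopy (mono := @mono n G Γ) (bit := fun c => tag c) (flip := @flip n G Γ)
          (step := step) (b := weighted) (d := dhat R n Γ)
          (h := homotopy) (pivot := pivot) _ _ _ _ _ _ _ _ _ _ pc cp).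
- by move=> p' q c'; exact: mono_flip.
- exact: flipK.
- exact: flipC.
- by move=> p' q c'; exact: tag_flip.
- exact: step_neq0.
- exact: step_flip.
- exact: step_anticommute.
- exact: pivot_flip.
- exact: dhat_weighted.
- exact: homotopy_weighted.
Qed.

Lemma Cspace_color_span i : Cspace R n Γ i = span (fun c => wt (tag c) == i).
Proof.
rewrite /Cspace; under eq_bigr do rewrite Vspace_color_span //.
rewrite (@sum_color_span R n G Γ _ (fun α c => tag c == α)) => [|α c /eqP//].
by apply: eq_bigl => c; rewrite eqxx andbT.
Qed.

Lemma sum_harmonic_color_span i :
  (\sum_(α : cube G | wt α == i) harmonic R n Γ α)%VS
  = span (fun c => (wt (tag c) == i) && rainbow c).
Proof.
under eq_bigr do rewrite harmonic_color_span //.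
rewrite (@sum_color_span R n G Γ _ (fun α c => (tag c == α) && rainbow c)).
  by apply: eq_bigl => c; rewrite eqxx.
by move=> α c /andP[/eqP].
Qed.

Lemma directv_harmonic i : directv (\sum_(α : cube G | wt α == i) harmonic R n Γ α)%VS.
Proof.
rewrite directvE /= sum_harmonic_color_span dim_color_span //.
under [X in _ == X]eq_bigr do rewrite harmonic_color_span // dim_color_span // -sum1_card.
rewrite -sum1_card (partition_big (@tag _ _) (fun α => wt α == i)) => [|c /andP[]//].
apply/eqP/eq_bigr => α /eqP wα; apply: eq_bigl => c; rewrite !unfold_in.
by case: (tag c =P α) => [->|_]; rewrite ?wα ?eqxx ?andbT ?andbF.
Qed.

Lemma wt_toggle (α : cube G) p : α p -> wt α = (wt (toggle α p)).+1.
Proof.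
move=> ap; rewrite /wt (bigD1 p) //= [in RHS](bigD1 p) //= ap !ffunE eqxx ap /=.
rewrite add1n add0n; congr (_.+1); apply: eq_bigr => q /negPf nq.
by rewrite ffunE nq addbF.
Qed.

Lemma homotopy_weighted_boundary c :
  d (homotopy (weighted c)) \in boundaries R n Γ (wt (tag c)).
Proof.
rewrite homotopy_weighted; case: pivot => [p|]; last by rewrite linear0 mem0v.
case: ifP => [cp|_]; last by rewrite linear0 mem0v.
rewrite (wt_toggle cp) /=; apply: memv_img; rewrite !memvZ // Cspace_color_span.
exact: mem_coloring_span.
Qed.

Lemma dhat_rainbow c : rainbow c -> d (e c) = 0.
Proof.
move=> /forallP rc; rewrite dhat_coloringE // big_pred0 // => p.
by rewrite (negPf (rc p)).
Qed.

(** The rainbow part of a cycle is a cycle; hence so is the rest, which the homotopy exhibits as a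
    boundary. The intersection on the right is the one that [dim_subquotient] divides by. *)
Lemma cycles_decomposition i :
  cycles R n Γ i = (span (fun c => (wt (tag c) == i) && rainbow c)
                    + (cycles R n Γ i :&: boundaries R n Γ i))%VS.
Proof.
apply/eqP; rewrite eqEsubv subv_add capvSl andbT; apply/andP; split; last first.
  rewrite subv_cap; apply/andP; split.
    by rewrite Cspace_color_span color_span_sub // => c /andP[].
  apply/subv_sumP => c /andP[_ rc]; rewrite -memvE memv_ker.
  by rewrite dhat_rainbow.
apply/subvP=> z; rewrite {1}/cycles Cspace_color_span memv_cap memv_ker.
case/andP=> /(mem_color_span n_gt0) zi /eqP dz.
pose z0 := \sum_(c | rainbow c) cf c z *: e c.
pose z1 := \sum_(c | ~~ rainbow c) (cf c z / weight c) *: weighted c.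
have zE : z = z0 + z1.
  rewrite {1}(coloring_expansion n_gt0 z) (bigID (@rainbow _ _ _)) /=; congr (_ + _).
  by apply: eq_bigr => c _; rewrite scalerA divfK ?weight_neq0.
have dz0 : d z0 = 0.
  by rewrite linear_sum big1 // => c rc; rewrite linearZ /= dhat_rainbow ?scaler0.
have dz1 : d z1 = 0 by rewrite -dz zE linearD /= dz0 add0r.
have z0H : z0 \in span (fun c => (wt (tag c) == i) && rainbow c).
  apply: memv_suml => c rc; have [wc|wc] := boolP (wt (tag c) == i).
    by rewrite memvZ // mem_coloring_span //= wc.
  by rewrite zi // scale0r mem0v.
have z1E : z1 = \sum_(c | ~~ rainbow c) (cf c z / weight c) *: d (homotopy (weighted c)).
  exact: (homotopy_cycle (d := dhat R n Γ) (h := homotopy) homotopyP dz1).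
have z1B : z1 \in boundaries R n Γ i.
  rewrite z1E; apply: memv_suml => c rc; have [wc|wc] := eqVneq (wt (tag c)) i.
    by rewrite memvZ // -wc homotopy_weighted_boundary.
  by rewrite zi // mul0r scale0r mem0v.
rewrite zE memv_add // memv_cap z1B andbT memv_cap memv_ker dz1 eqxx andbT.
rewrite Cspace_color_span; apply: memv_suml => c _.
have [wc|wc] := boolP (wt (tag c) == i).
  by rewrite !memvZ // mem_coloring_span.
by rewrite zi // mul0r scale0r mem0v.
Qed.

Lemma boundaries_rainbow i P :
  (span (fun c => P c && rainbow c) :&: boundaries R n Γ i = 0)%VS.
Proof.
apply/eqP; rewrite -subv0; apply/subvP=> v; rewrite memv_cap memv0 => /andP[vH vB].
apply/eqP/(color_coord_inj n_gt0) => c; rewrite color_coord0.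
have [rc|rc] := boolP (rainbow c).
  case: i vB => [|j] /=; first by rewrite memv0 => /eqP->; rewrite color_coord0.
  by case/memv_imgP=> u _ ->; rewrite color_coord_dhat_rainbow.
by apply: (mem_color_span n_gt0 _ _ vH); rewrite negb_and rc orbT.
Qed.

Lemma dim_homology i :
  \dim {:homology R n Γ i} = \dim (\sum_(α : cube G | wt α == i) harmonic R n Γ α)%VS.
Proof.
rewrite dim_subquotient sum_harmonic_color_span {1}cycles_decomposition.
rewrite dimv_disjoint_sum ?addnK // capvA (capvC _ (cycles _ _ _ _)) -capvA.
by rewrite boundaries_rainbow capv0.
Qed.

End Homology.

(** * Parity on the sphere, over the field with two elements *)

Section Planar.
Variables (G : mgraph) (Γ : ribbon G).
Implicit Types (h : hedge G) (v : vert G).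

Lemma F2_addrr (x : 'F_2) : x + x = 0.
Proof. by rewrite addrr_pchar2 ?pchar_Fp. Qed.

Lemma F2_addr_eq0 (x y : 'F_2) : x + y = 0 -> x = y.
Proof. by move=> xy; rewrite -[x]addr0 -(F2_addrr y) addrA xy add0r. Qed.

Lemma vertex_invariant T (g : point G -> T) :
  arc_invariant Γ g -> (forall h, g (flag (h, false)) = g (flag (h, true))) ->
  forall h h' s s', hinc h = hinc h' -> g (flag (h, s)) = g (flag (h', s')).
Proof.
move=> ga gv h h' s s' hh'.
have gs h1 s1 : g (flag (h1, s1)) = g (flag (h1, true)) by case: s1.
rewrite !gs; have : h' \in porbit (rot Γ) h by rewrite Defs.rot_cycle inE hh'.
case/porbitP=> k ->; elim: k => [|k IHk]; first by rewrite expg0 perm1.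
by rewrite expgSr permM IHk ga gs.
Qed.

Lemma connected_invariant T (x : vert G -> T) :
    mconnected G -> (forall h, x (hinc h) = x (hinc (hopp h))) ->
  forall u v, x u = x v.
Proof.
case=> _ Gconn xh u v; have /connectP[q + ->] := Gconn u v.
elim: q u => [|w q IHq] u //= /andP[/existsP[h /andP[/eqP <- /eqP hw]]].
by rewrite xh hw; exact: IHq.
Qed.

Lemma sum_hedge (V : nmodType) (f : hedge G -> V) :
  \sum_h f h = \sum_(e < nedge G) (f (e, false) + f (e, true)).
Proof.
transitivity (\sum_(e < nedge G) \sum_(b : bool) f (e, b)).
  by rewrite pair_big; apply: eq_bigr => -[].
by apply: eq_bigr => e _; rewrite big_bool addrC.
Qed.

(** Each arc of the vertex circle contributes equal values at its two ends, which cancel mod 2. *)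
Lemma sum_arc_invariant (g : point G -> 'F_2) v : arc_invariant Γ g ->
  \sum_(h : hedge G | hinc h == v) (g (flag (h, false)) + g (flag (h, true))) = 0.
Proof.
move=> ga; rewrite big_split /= [X in X + _](reindex_inj (@perm_inj _ (rot Γ))) /=.
rewrite (eq_bigl (fun h => hinc h == v)) => [|h].
  by under eq_bigr do rewrite -ga; rewrite F2_addrr.
have : rot Γ h \in porbit (rot Γ) h by rewrite (mem_porbit _ 1).
by rewrite Defs.rot_cycle inE => /eqP->.
Qed.

Hypothesis Γplanar : planar Γ.
Hypothesis has_edge : (0 < nedge G)%N.

(** Connectedness and one edge exclude isolated vertices, whose circles carry no flags. *)
Lemma hedge_at v : exists h : hedge G, hinc h = v.
Proof.
case: Γplanar => -[_ /(_ v)Gconn] _.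
pose h0 : hedge G := (Ordinal has_edge, false).
have /connectP[[|w q] /=] := Gconn (hinc h0); first by move=> _ ev; exists h0.
by case/andP=> /existsP[h /andP[/eqP hv _]] _ _; exists h.
Qed.

Lemma point_flag (x : point G) : exists z, x = flag z.
Proof.
case: x => -[z|v] xb; first by exists z; exact: val_inj.
exfalso; have [h hv] := hedge_at v.
by have /forallP/(_ h) := xb; rewrite hv eqxx.
Qed.

(** The mod 2 boundary map from faces to edges; the transpose of [vertex_mx] is the one from edges
    to vertices. *)
Definition face_mx : 'M['F_2]_(#|circle Γ|, nedge G) :=
  \matrix_(i, e) ((face Γ (flag ((e, false), false)) == enum_val i)%:R
                  + (face Γ (flag ((e, false), true)) == enum_val i)%:R).

Definition vertex_mx : 'M['F_2]_(#|vert G|, nedge G) :=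
  \matrix_(i, e) ((hinc (e, false) == enum_val i)%:R + (hinc (e, true) == enum_val i)%:R).

Lemma sum_delta (T : finType) (a : T) (f : T -> 'F_2) : \sum_t f t * (a == t)%:R = f a.
Proof.
rewrite (bigD1 a) //= eqxx mulr1 big1 ?addr0 // => t nt.
by rewrite eq_sym (negPf nt) mulr0.
Qed.

Lemma sum_enum_val (T : finType) (f : T -> 'F_2) :
  \sum_(i < #|T|) f (enum_val i) = \sum_t f t.
Proof. by rewrite -big_enum_val. Qed.

Lemma mul_face_mx (x : 'rV['F_2]_#|circle Γ|) e :
  (x *m face_mx) 0 e = x 0 (enum_rank (face Γ (flag ((e, false), false))))
                     + x 0 (enum_rank (face Γ (flag ((e, false), true)))).
Proof.
pose f a S := x 0 (enum_rank S) * (face Γ (flag ((e, false), a)) == S)%:R.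
transitivity (\sum_S (f false S + f true S)); last by rewrite big_split /= !sum_delta.
rewrite -sum_enum_val mxE; apply: eq_bigr => i _.
by rewrite /f mxE enum_valK mulrDr.
Qed.

Lemma mul_vertex_mx (x : 'rV['F_2]_#|vert G|) e :
  (x *m vertex_mx) 0 e = x 0 (enum_rank (hinc (e, false)))
                       + x 0 (enum_rank (hinc (e, true))).
Proof.
pose f a v := x 0 (enum_rank v) * (hinc (e, a) == v)%:R.
transitivity (\sum_v (f false v + f true v)); last by rewrite big_split /= !sum_delta.
rewrite -sum_enum_val mxE; apply: eq_bigr => i _.
by rewrite /f mxE enum_valK mulrDr.
Qed.

Lemma rank_const_ker m k (A : 'M['F_2]_(m, k)) :
  (forall x : 'rV_m, x *m A = 0 -> forall i j, x 0 i = x 0 j) -> (m <= \rank A + 1)%N.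
Proof.
case: m A => [//|m] A xc; rewrite -leq_subLR -mxrank_ker.
apply: (leq_trans _ (rank_leq_row (const_mx 1 : 'rV['F_2]_m.+1))).
apply/mxrankS/rV_subP => x /sub_kermxP /xc cx.
apply/sub_rVP; exists (x 0 ord0); apply/rowP => i.
by rewrite !mxE mulr1.
Qed.

Lemma rank_vertex_mx : (#|vert G| <= \rank vertex_mx + 1)%N.
Proof.
apply: rank_const_ker => x x0 i j.
rewrite -(enum_valK i) -(enum_valK j).
apply: (@connected_invariant _ (fun v => x 0 (enum_rank v))); first by case: Γplanar.
have xe e : x 0 (enum_rank (hinc (e, false))) = x 0 (enum_rank (hinc (e, true))).
  by apply: F2_addr_eq0; rewrite -mul_vertex_mx x0 mxE.
by case=> e [] /=; rewrite xe.
Qed.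

(** A vector in the left kernel takes equal values on the two sides of every edge, hence one value
    around each vertex and the same at both ends of an edge; connectedness of [G] does the rest. *)
Lemma rank_face_mx : (#|circle Γ| <= \rank face_mx + 1)%N.
Proof.
apply: rank_const_ker => x x0 i j.
pose g y := x 0 (enum_rank (face Γ y)).
have ga : arc_invariant Γ g by move=> h; rewrite /g face_arc.
have gb : band_invariant Γ g by move=> h s; rewrite /g face_across.
have ge e : g (flag (e, false, false)) = g (flag (e, false, true)).
  by apply: F2_addr_eq0; rewrite -mul_face_mx x0 mxE.
have gv h : g (flag (h, false)) = g (flag (h, true)).
  case: h => e [] //; rewrite -(gb (e, true) false) -(gb (e, true) true).
  by rewrite /across /hopp /=; case: ifP => _; rewrite ge.
have gh h s : g (flag (h, s)) = g (flag (hopp h, s)).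
  by rewrite -(gb h s) /across /=; case: ifP => _ //; case: s; rewrite gv.
suff gc y y' : g y = g y'.
  rewrite -(enum_valK i) -(enum_valK j).
  rewrite -[enum_val i]repK -[enum_val j]repK; exact: gc.
have [[h s] ->] := point_flag y; have [[h' s'] ->] := point_flag y'.
have gvE := vertex_invariant ga gv.
(* The set of values of [g] at [v], a singleton by [UE], turns [g] into a function of vertices that
   [connected_invariant] can transport. *)
pose U v := [pred k : 'F_2 |
  [exists h : hedge G, (hinc h == v) && (g (flag (h, true)) == k)]].
have UE h1 k : U (hinc h1) k = (g (flag (h1, true)) == k).
  apply/existsP/idP => [[h2 /andP[/eqP h12 /eqP <-]]|h1k]; first exact/eqP/gvE.
  by exists h1; rewrite eqxx.
have := @connected_invariant _ (fun v => U v (g (flag (h, true)))) _ _ (hinc h) (hinc h').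
rewrite !UE eqxx => Uc.
rewrite (gvE h h s true) // (gvE h' h' s' true) //; apply/esym/eqP; rewrite -Uc //.
  by case: Γplanar.
by move=> h1; rewrite !UE [in RHS]gh hoppK.
Qed.

Lemma sum_vertex_edges (y : 'I_(nedge G) -> 'F_2) v :
  \sum_(h : hedge G | hinc h == v) y h.1
  = \sum_e y e * ((hinc (e, false) == v)%:R + (hinc (e, true) == v)%:R).
Proof.
rewrite big_mkcond sum_hedge; apply: eq_bigr => e _ /=.
by case: (_ == v); case: (_ == v); rewrite /= mulrDr ?mulr1 ?mulr0 ?addr0 ?add0r.
Qed.

Lemma face_vertex_mx : face_mx *m vertex_mx^T = 0.
Proof.
apply/matrixP => i j; rewrite !mxE.
pose g y : 'F_2 := (face Γ y == enum_val i)%:R.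
transitivity (\sum_e face_mx i e * ((hinc (e, false) == enum_val j)%:R
                                     + (hinc (e, true) == enum_val j)%:R)).
  by apply: eq_bigr => e _; congr (_ * _); rewrite !mxE.
rewrite -sum_vertex_edges -[RHS](sum_arc_invariant (g := g) (enum_val j)) => [|h].
  apply: eq_bigr => -[e b] _; rewrite mxE -/(g _) -/(g _); case: b => //=.
  rewrite {3 4}/g -(face_across Γ (e, true) true) -(face_across Γ (e, true) false).
  by rewrite /across /hopp /=; case: ifP => _; rewrite // addrC.
by rewrite /g face_arc.
Qed.

(* By connectedness both matrices have corank at most one, so Euler's formula
   makes the rows of [face_mx] span the cycle space. *)
Lemma planar_cycle_boundary (y : 'I_(nedge G) -> 'F_2) :
  (forall v, \sum_(h : hedge G | hinc h == v) y h.1 = 0) ->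
  exists X : circle Γ -> 'F_2, forall e,
    y e = X (face Γ (flag ((e, false), false))) + X (face Γ (flag ((e, false), true))).
Proof.
move=> yv; pose Y : 'rV_(nedge G) := \row_e y e.
have /submxP[D YD] : (Y <= face_mx)%MS.
  apply: (@submx_trans _ _ _ _ _ _ (kermx vertex_mx^T)).
    apply/sub_kermxP/rowP => j; rewrite !mxE -[RHS](yv (enum_val j)) sum_vertex_edges.
    by apply: eq_bigr => e _; rewrite !mxE.
  have /mxrank_leqif_sup : (face_mx <= kermx vertex_mx^T)%MS.
    by apply/sub_kermxP/face_vertex_mx.
  move=> /leqifP; case: ifP => // _; rewrite ltnNge => /negP[].
  rewrite mxrank_ker mxrank_tr leq_subLR.
  have [_ euler] := Γplanar.
  by have := leq_add rank_vertex_mx rank_face_mx; rewrite euler addnACA leq_add2r.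
exists (fun S => D 0 (enum_rank S)) => e.
by rewrite -mul_face_mx -YD mxE.
Qed.

Section Parity.
Variables (n : nat) (α : cube G) (f : {ffun circle (state_graph Γ α) -> 'I_n}).
Hypothesis f_coloring : face_coloring f.
Local Notation Γα := (state_graph Γ α).

Let x (k : 'I_n) (y : point G) : 'F_2 := (f (face Γα y) == k)%:R.
Let dx k h := x k (flag (h, false)) + x k (flag (h, true)).

Let x_arc k : arc_invariant Γ (x k).
Proof. by move=> h; rewrite /x (face_arc Γα). Qed.

Let x_band k : band_invariant Γα (x k).
Proof. by move=> h s; rewrite /x face_across. Qed.

Lemma band_difference (Δ : ribbon G) (g : point G -> 'F_2) e : band_invariant Δ g ->
  g (flag ((e, true), false)) + g (flag ((e, true), true))
  = g (flag ((e, false), false)) + g (flag ((e, false), true)).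
Proof.
move=> gb; rewrite -(gb (e, true) false) -(gb (e, true) true) /across /hopp /=.
by case: ifP => _ //; rewrite addrC.
Qed.

(* The circles of two colors cross an even number of times: the circles of
   color [j] bound a set [X] of faces up to a function [U] of the vertices, whose
   coboundary counts the twisted edges along them. *)
Lemma crossings_even j k : \sum_e (α e)%:R * (dx j (e, false) * dx k (e, false)) = 0.
Proof.
have dxE i h : dx i h = dx i (h.1, false).
  by case: h => e [] //; exact: (band_difference e (x_band i)).
have [X XE] : exists X : circle Γ -> 'F_2, forall e, dx j (e, false) =
    X (face Γ (flag ((e, false), false))) + X (face Γ (flag ((e, false), true))).
  apply: (planar_cycle_boundary (y := fun e => dx j (e, false))) => v.
  under eq_bigr do rewrite -dxE.
  exact: sum_arc_invariant.
(* Both summands jump equally across each edge, so mod 2 their sum depends only on the vertex. *)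
pose u y := x j y + X (face Γ y).
have u_arc : arc_invariant Γ u by move=> h; rewrite /u face_arc x_arc.
have X_band : band_invariant Γ (fun y => X (face Γ y)) by move=> h s; rewrite face_across.
have u_flat h : u (flag (h, false)) = u (flag (h, true)).
  apply: F2_addr_eq0; rewrite /u addrACA -/(dx j h) dxE XE.
  suff -> : X (face Γ (flag (h, false))) + X (face Γ (flag (h, true)))
     = X (face Γ (flag (h.1, false, false))) + X (face Γ (flag (h.1, false, true))).
    exact: F2_addrr.
  by case: h => e [] //; exact: (band_difference e X_band).
have hinc_surj v : exists h : hedge G, hinc h == v.
  by have [h <-] := hedge_at v; exists h.
pose U v := u (flag (xchoose (hinc_surj v), true)).
have uE h s : u (flag (h, s)) = U (hinc h).
  by apply: (vertex_invariant u_arc u_flat); exact/esym/eqP/(xchooseP (hinc_surj _)).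
(* The far corner that [Γ] joins to side [false] of [(e, false)] is joined in the state to side
   [α e]. Along [e] the [X] parts cancel, and what remains is the jump of [x j] if [e] is twisted
   and zero otherwise. *)
have dU e : (α e)%:R * dx j (e, false) = U (hinc (e, false)) + U (hinc (e, true)).
  rewrite -(uE (e, false) false) -(uE (e, true) (~~ twist Γ e)) /u.
  have -> : face Γ (flag ((e, true), ~~ twist Γ e)) = face Γ (flag ((e, false), false)).
    by rewrite -(face_across Γ (e, false) false) /across /hopp /=; case: (twist Γ e).
  have -> : x j (flag ((e, true), ~~ twist Γ e)) = x j (flag ((e, false), α e)).
    rewrite -(x_band j (e, false) (α e)) /across /hopp /= ffunE.
    by case: (twist Γ e); case: (α e).
  rewrite addrACA F2_addrr addr0 /dx.
  by case: (α e); rewrite ?mul1r // mul0r F2_addrr.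
under eq_bigr do rewrite mulrA dU.
(* Summation by parts: regrouped by vertices, each [U v] multiplies the sum of [dx k] around [v],
   which is zero. *)
transitivity (\sum_h U (hinc h) * dx k h).
  rewrite sum_hedge; apply: eq_bigr => e _.
  by rewrite (dxE k (e, true)) mulrDl.
rewrite (partition_big (@hinc G) xpredT) //= big1 // => v _.
rewrite (eq_bigr (fun h => U v * dx k h)) => [|h /eqP->//].
by rewrite -mulr_sumr sum_arc_invariant ?mulr0.
Qed.

(** Every edge separates exactly one pair of colors [j < k], so adding the even crossing numbers
    over all pairs counts each twisted edge once. *)
Lemma planar_coloring_even : ~~ odd (wt α).
Proof.
have one e : \sum_(j < n) \sum_(k : 'I_n | (j < k)%N)
               dx j (e, false) * dx k (e, false) = 1.
  have /face_coloringP/(_ e) := f_coloring.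
  rewrite /dx /x; move: (f _) (f _) => b a ab.
  (* The sum of the jumps of the colors above [j]. Only [j = a] and [j = b] contribute, with total
     [(a < b) + (b < a) = 1]. *)
  pose T (j : 'I_n) : 'F_2 := (j < a)%:R + (j < b)%:R.
  transitivity (\sum_(j < n) (T j * (a == j)%:R + T j * (b == j)%:R)).
    apply: eq_bigr => j _; rewrite -mulr_sumr [LHS]mulrC -mulrDr; congr (_ * _).
    rewrite big_mkcond /= /T -(sum_delta a (fun k : 'I_n => (j < k)%:R)).
    rewrite -(sum_delta b (fun k : 'I_n => (j < k)%:R)) -big_split.
    by apply: eq_bigr => k _ /=; case: (j < k)%N; rewrite ?mul1r ?mul0r ?addr0.
  rewrite big_split /= !sum_delta /T !ltnn addr0 add0r -natrD.
  by case: (ltngtP a b) => // /val_inj e'; rewrite e' eqxx in ab.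
have : (wt α)%:R = 0 :> 'F_2.
  rewrite /wt natr_sum.
  transitivity (\sum_(j < n) \sum_(k : 'I_n | (j < k)%N)
                 \sum_e (α e)%:R * (dx j (e, false) * dx k (e, false))).
    under [RHS]eq_bigr do rewrite exchange_big.
    rewrite exchange_big; apply: eq_bigr => e _ /=.
    by under eq_bigr do rewrite -mulr_sumr; rewrite -mulr_sumr one mulr1.
  by rewrite big1 // => j _; rewrite big1 // => k _; exact: crossings_even.
by move/eqP; rewrite -(dvdn_pcharf (pchar_Fp (isT : prime 2))) dvdn2.
Qed.

End Parity.
End Planar.

Theorem theoremD (R : realType) (G : mgraph) (Γ : ribbon G) (n : nat)
    (hG : mconnected G) (hn : (1 < n)%N) :
  (* (1) *)
  [/\ forall i : nat,
        directv (\sum_(α : cube G | wt α == i) harmonic R n Γ α)%VS /\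
        lin_isomorphic (homology R n Γ i)
          (subvs_of (\sum_(α : cube G | wt α == i) harmonic R n Γ α)%VS),
      planar Γ -> forall α : cube G, harmonic R n Γ α != 0%VS -> ~~ odd (wt α),
  (* (2) *)
      forall α : cube G,
        \dim (harmonic R n Γ α) = num_face_colorings n (state_graph Γ α),
  (* (3) *)
      [/\ ribbon_equiv (state_graph Γ [ffun=> false]) Γ,
          \dim {:homology R n Γ 0} = \dim (harmonic R n Γ [ffun=> false]) &
          \dim (harmonic R n Γ [ffun=> false]) = num_face_colorings n Γ] &
      planar Γ -> \dim {:homology R 4 Γ 0} = num_face_colorings 4 Γ].
Proof.
have n_gt0 : (0 < n)%N := ltnW hn.
have zero_state : state_graph Γ [ffun=> false] = Γ.
  case: {hG} Γ => r t rc; rewrite /state_graph /=.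
  suff -> : [ffun e => t e (+) [ffun=> false] e] = t by [].
  by apply/ffunP=> e; rewrite !ffunE addbF.
(* Stated for every [k] because the last claim takes four colors whatever [n] is. *)
have homology0 k : (0 < k)%N ->
    \dim {:homology R k Γ 0} = \dim (harmonic R k Γ [ffun=> false]).
  move=> k_gt0; rewrite dim_homology // (big_pred1 [ffun=> false]) // => α.
  rewrite /wt sum_nat_eq0; apply/forallP/eqP => [α0|-> e]; last by rewrite ffunE.
  by apply/ffunP=> e; rewrite ffunE; have := α0 e; rewrite eqb0 => /negPf.
split.
- move=> i; split; first exact: directv_harmonic.
  by apply: lin_isomorphic_dim; rewrite dim_homology // [RHS]dimvf.
- move=> Γplanar α; rewrite -dimv_eq0 dim_harmonic // cards_eq0.
  case/set0Pn=> f; rewrite inE => fc.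
  (* The parity argument supposes an edge; without edges the weight is an empty sum. *)
  have [G0|G_gt0] := posnP (nedge G); last exact: (planar_coloring_even Γplanar G_gt0 fc).
  by rewrite /wt big1 // => e _; have := ltn_ord e; rewrite {2}G0.
- by move=> α; rewrite dim_harmonic.
- split; [|exact: homology0|by rewrite dim_harmonic // zero_state].
  exists id, id, (fun=> false); split=> //; try by exists id.
  by move=> h; rewrite !ffunE !addbF.
- by move=> _; rewrite homology0 // dim_harmonic // zero_state.
Qed.
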